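(* Let $d\geq 1$, let $A$ be a finite-dimensional algebra over a field, let $\mathcal{M}\subseteq \operatorname{mod}A$ be a $d$-cluster tilting subcategory and let $\mathcal{U}\subseteq\mathcal{M}$ be a functorially finite $d$-torsion class. Let $M_{\mathcal{U}}$ be a basic $\operatorname{Ext}^d$-projective generator of $\mathcal{U}$. Then $M_{\mathcal{U}}$ is a $d$-tilting module over $A/\operatorname{Ann}\mathcal{U}$.
   Context: $\operatorname{mod}A$ is the category of finitely generated right $A$-modules. All subcategories are full and closed under isomorphisms, finite direct sums and direct summands. A functorially finite subcategory $\mathcal{M}\subseteq\operatorname{mod}A$ is $d$-cluster tilting if $\mathcal{M}=\{X\mid \operatorname{Ext}^i_A(X,M)=0\ \forall M\in\mathcal{M},\,1\le i\le d-1\}=\{Y\mid \operatorname{Ext}^i_A(M,Y)=0\ \forall M\in\mathcal{M},\,1\le i\le d-1\}$. A subcategory $\mathcal{U}\subseteq\mathcal{M}$ is a $d$-torsion class if for every $M\in\mathcal{M}$ there is an exact sequence $0\to U_M\to M\to V_1\to\cdots\to V_d\to 0$ in $\operatorname{mod}A$ with all terms in $\mathcal{M}$, such that $U_M\in\mathcal{U}$ and $0\to\operatorname{Hom}_A(U,V_1)\to\cdots\to\operatorname{Hom}_A(U,V_d)\to 0$ is exact for every $U\in\mathcal{U}$. $X\in\mathcal{U}$ is $\operatorname{Ext}^d$-projective in $\mathcal{U}$ if $\operatorname{Ext}^d_A(X,U)=0$ for all $U\in\mathcal{U}$; it is an $\operatorname{Ext}^d$-projective generator of $\mathcal{U}$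 if moreover every $\operatorname{Ext}^d$-projective object of $\mathcal{U}$ lies in $\operatorname{add}(X)$. $\operatorname{Ann}\mathcal{U}=\{a\in A\mid U\cdot a=0\text{ for all }U\in\mathcal{U}\}$; objects of $\mathcal{U}$ are naturally modules over $A/\operatorname{Ann}\mathcal{U}$. A module $T$ over a finite-dimensional algebra $B$ is $d$-tilting if $\operatorname{pd}_BT\le d$, $\operatorname{Ext}^i_B(T,T)=0$ for all $i>0$, and there is an exact sequence $0\to B\to T_0\to\cdots\to T_d\to 0$ with all $T_i\in\operatorname{add}(T)$. *)

(* Defs.v *)
From HB Require Import structures.
From mathcomp Require Import all_boot all_order all_algebra all_field.
From mathcomp Require Import generic_quotient ring_quotient.
From mathcomp Require Import boolp.

Set Implicit Arguments.
Unset Strict Implicit.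
Unset Printing Implicit Defensive.

Import GRing.Theory.
Local Open Scope ring_scope.

(* Everything below is about left modules over a possibly trivial ring R, i.e.
   [lmodType R].  Right modules over A are [lmodType A^c], with A^c the converse
   ring: (a : A^c) *: x is x.a. *)

Section Modules.
Variable R : pzRingType.
Implicit Types (X Y Z : lmodType R) (C : lmodType R -> Prop).

Definition fgmod X : Prop :=
  exists (n : nat) (e : 'I_n -> X),
    forall x, exists c : 'I_n -> R, x = \sum_i c i *: e i.

Definition zeromod X : Prop := forall x : X, x = 0.

Definition isomod X Y : Prop := exists f : {linear X -> Y}, bijective f.

Definition exact X Y Z (f : {linear X -> Y}) (g : {linear Y -> Z}) : Prop :=
  forall y, g y = 0 <-> exists x, f x = y.

Definition surjection X Y (f : {linear X -> Y}) : Prop :=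
  forall y, exists x, f x = y.

Definition projective X : Prop :=
  forall Y Z (g : {linear Y -> Z}) (f : {linear X -> Z}), surjection g ->
  exists h : {linear X -> Y}, forall x, g (h x) = f x.

(* ... -> P_2 -> P_1 -> P_0 -> X -> 0 *)
Record proj_resolution X := ProjResolution {
  res_obj :> nat -> lmodType R;
  res_diff : forall i, {linear res_obj i.+1 -> res_obj i};
  res_aug : {linear res_obj 0%N -> X};
  res_proj : forall i, projective (res_obj i);
  res_surj : surjection res_aug;
  res_exact0 : exact (res_diff 0) res_aug;
  res_exactS : forall i, exact (res_diff i.+1) (res_diff i)
}.

Definition pd_le (d : nat) X : Prop :=
  exists P : proj_resolution X, forall i, (d < i)%N -> zeromod (P i).

Definition cocycle X Y (P : proj_resolution X) i (f : {linear P i -> Y}) : Prop :=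
  forall x : P i.+1, f (res_diff P i x) = 0.

Definition coboundary X Y (P : proj_resolution X) i :
    {linear P i -> Y} -> Prop :=
  match i return {linear P i -> Y} -> Prop with
  | 0 => fun f => forall x, f x = 0
  | j.+1 => fun f => exists g : {linear P j -> Y},
                       forall x, f x = g (res_diff P j x)
  end.

(* Ext^i(X, Y) = 0, i.e. H^i(Hom(P, Y)) = 0 for P a projective resolution of X;
   this does not depend on the choice of P. *)
Definition Ext_eq0 (i : nat) X Y : Prop :=
  forall (P : proj_resolution X) (f : {linear P i -> Y}),
    cocycle f -> coboundary f.

(* Y is a direct summand of some X^n. *)
Definition add_of X Y : Prop :=
  exists (n : nat) Z, isomod ({ffun 'I_n -> X} : lmodType R) (Y * Z)%type.

Definition indecomposable X : Prop :=
  ~ zeromod X /\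
  forall Y Z, isomod X (Y * Z)%type -> zeromod Y \/ zeromod Z.

Definition dsum (s : seq (lmodType R)) : lmodType R :=
  foldr (fun X Y : lmodType R => (X * Y)%type : lmodType R)
        ('rV[R]_0 : lmodType R) s.

Definition basic X : Prop :=
  exists (n : nat) (S : 'I_n -> lmodType R),
    [/\ forall i, indecomposable (S i),
        forall i j, isomod (S i) (S j) -> i = j
      & isomod X (dsum [seq S i | i <- enum 'I_n])].

(* Full subcategories of the category of finitely generated modules, closed under
   isomorphisms, finite direct sums and direct summands. *)
Record subcategory C : Prop := Subcategory {
  subcat_fg : forall X, C X -> fgmod X;
  subcat_iso : forall X Y, isomod X Y -> C X -> C Y;
  subcat_zero : forall X, zeromod X -> C X;
  subcat_sum : forall X Y, C X -> C Y -> C (X * Y)%type;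
  subcat_summand : forall X Y, C (X * Y)%type -> C X
}.

Definition right_approximation C X Z (f : {linear Z -> X}) : Prop :=
  C Z /\ forall Y (g : {linear Y -> X}), C Y ->
    exists h : {linear Y -> Z}, forall y, f (h y) = g y.

Definition left_approximation C X Z (f : {linear X -> Z}) : Prop :=
  C Z /\ forall Y (g : {linear X -> Y}), C Y ->
    exists h : {linear Z -> Y}, forall x, h (f x) = g x.

Definition functorially_finite C : Prop :=
  forall X, fgmod X ->
    (exists Z (f : {linear Z -> X}), right_approximation C f) /\
    (exists Z (f : {linear X -> Z}), left_approximation C f).

Definition cluster_tilting (d : nat) C : Prop :=
  [/\ subcategory C,
      functorially_finite C,
      forall X, C X <-> fgmod X /\
        forall M, C M -> forall i, (0 < i < d)%N -> Ext_eq0 i X M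
    & forall Y, C Y <-> fgmod Y /\
        forall M, C M -> forall i, (0 < i < d)%N -> Ext_eq0 i M Y].

(* 0 -> X -> V 0 -> V 1 -> ... -> V n.-1 -> 0 is an exact sequence, the terms
   V i with n <= i being zero, is encoded as
   [injective f /\ exact f (g 0) /\ exact_tail n g]. *)
Definition exact_tail (n : nat) (V : nat -> lmodType R)
    (g : forall i, {linear V i -> V i.+1}) : Prop :=
  (forall i, exact (g i) (g i.+1)) /\ (forall i, (n <= i)%N -> zeromod (V i)).

(* 0 -> Hom(X, V 0) -> Hom(X, V 1) -> ... is exact. *)
Definition Hom_exact X (V : nat -> lmodType R)
    (g : forall i, {linear V i -> V i.+1}) : Prop :=
  (forall h : {linear X -> V 0%N},
     (forall x, g 0%N (h x) = 0) -> forall x, h x = 0) /\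
  (forall i (h : {linear X -> V i.+1}),
     (forall x, g i.+1 (h x) = 0) <->
     exists h' : {linear X -> V i}, forall x, h x = g i (h' x)).

(* The V_1, ..., V_d of the mathematical definition are V 0, ..., V d.-1. *)
Definition torsion_class (d : nat) (M U : lmodType R -> Prop) : Prop :=
  [/\ subcategory U,
      forall X, U X -> M X
    & forall X, M X ->
      exists (UX : lmodType R) (V : nat -> lmodType R)
             (u : {linear UX -> X}) (v : {linear X -> V 0%N})
             (g : forall i, {linear V i -> V i.+1}),
        [/\ U UX, forall i, M (V i),
            [/\ injective u, exact u v, exact v (g 0%N) & exact_tail d g]
          & forall Y, U Y -> Hom_exact Y g]].

Definition Ext_projective (d : nat) (U : lmodType R -> Prop) X : Prop :=
  U X /\ forall Y, U Y -> Ext_eq0 d X Y.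

Definition Ext_projective_generator (d : nat) (U : lmodType R -> Prop) X : Prop :=
  Ext_projective d U X /\ forall Y, Ext_projective d U Y -> add_of X Y.

(* The regular module of R is [R^o]. *)
Definition tilting (d : nat) X : Prop :=
  [/\ fgmod X,
      pd_le d X,
      forall i, (0 < i)%N -> Ext_eq0 i X X
    & exists (T : nat -> lmodType R) (f : {linear R^o -> T 0%N})
             (g : forall i, {linear T i -> T i.+1}),
        [/\ forall i, (i <= d)%N -> add_of X (T i),
            injective f, exact f (g 0%N) & exact_tail d.+1 g]].

End Modules.

(* Quotient of a (noncommutative, possibly trivial) ring by a two-sided ideal;
   [Quotient.quot I] is the library's quotient of the underlying additive group. *)

HB.mixin Record isTwoSidedIdeal (A : pzRingType) (I : A -> bool) := {
  ideal_mull : forall a x, x \in (I : {pred A}) -> a * x \in (I : {pred A});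
  ideal_mulr : forall a x, x \in (I : {pred A}) -> x * a \in (I : {pred A})
}.

#[short(type="twoSidedIdeal")]
HB.structure Definition TwoSidedIdeal (A : pzRingType) :=
  {I of isTwoSidedIdeal A I & GRing.ZmodClosed A I}.

Definition quot_ring (A : pzRingType) (I : twoSidedIdeal A) : Type := Quotient.quot I.

Section QuotientRing.
Variables (A : pzRingType) (I : twoSidedIdeal A).
Local Notation B := (quot_ring I).
Local Open Scope quotient_scope.

HB.instance Definition _ := GRing.Zmodule.on B.
HB.instance Definition _ := Quotient.on B.

Definition quot_one : B := \pi_B 1.
Definition quot_mul (x y : B) : B := \pi_B (repr x * repr y).

Lemma quot_eqP (a b : A) : reflect (\pi_B a = \pi_B b) (a - b \in I).
Proof. by rewrite Quotient.idealrBE; apply: eqP. Qed.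

Lemma quot_repr_sub (a : A) : repr (\pi_B a) - a \in I.
Proof. by apply/quot_eqP; rewrite reprK. Qed.

Lemma quot_pi_mul (a b : A) : quot_mul (\pi_B a) (\pi_B b) = \pi_B (a * b).
Proof.
rewrite /quot_mul; apply/quot_eqP; set a' := repr _; set b' := repr _.
rewrite -[a' * b'](addrNK (a * b')) -addrA -mulrBl -mulrBr.
apply: rpredD; first exact/ideal_mulr/quot_repr_sub.
exact/ideal_mull/quot_repr_sub.
Qed.

Lemma quot_pi_add (a b : A) : \pi_B a + \pi_B b = \pi_B (a + b).
Proof. exact: (esym (@Quotient.pi_add _ I a b)). Qed.

Lemma quot_mulA : associative quot_mul.
Proof.
elim/quotW=> a; elim/quotW=> b; elim/quotW=> c.
by rewrite (quot_pi_mul b c) (quot_pi_mul a b) (quot_pi_mul a) (quot_pi_mul (a * b)) mulrA.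
Qed.

Lemma quot_mul1l : left_id quot_one quot_mul.
Proof. by elim/quotW=> a; rewrite (quot_pi_mul 1 a) mul1r. Qed.

Lemma quot_mul1r : right_id quot_one quot_mul.
Proof. by elim/quotW=> a; rewrite (quot_pi_mul a 1) mulr1. Qed.

Lemma quot_mulDl : left_distributive quot_mul +%R.
Proof.
elim/quotW=> a; elim/quotW=> b; elim/quotW=> c.
rewrite (quot_pi_mul a c) (quot_pi_mul b c) (quot_pi_add a b).
by rewrite (quot_pi_mul (a + b) c) (quot_pi_add (a * c)) mulrDl.
Qed.

Lemma quot_mulDr : right_distributive quot_mul +%R.
Proof.
elim/quotW=> a; elim/quotW=> b; elim/quotW=> c.
rewrite (quot_pi_mul a b) (quot_pi_mul a c) (quot_pi_add b c).
by rewrite (quot_pi_mul a (b + c)) (quot_pi_add (a * b)) mulrDr.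
Qed.

HB.instance Definition _ := GRing.Zmodule_isPzRing.Build B
  quot_mulA quot_mul1l quot_mul1r quot_mulDl quot_mulDr.

End QuotientRing.

(* A right A-module X killed by the two-sided ideal I, as a right A/I-module. *)

Definition quot_module (A : pzRingType) (I : twoSidedIdeal A) (X : lmodType A^c)
  (killed : forall a : A^c, a \in (I : {pred A}) -> forall x : X, a *: x = 0) : Type := X.

Section QuotientModule.
Variables (A : pzRingType) (I : twoSidedIdeal A) (X : lmodType A^c).
Hypothesis killed :
  forall a : A^c, a \in (I : {pred A}) -> forall x : X, a *: x = 0.
Local Notation B := (quot_ring I).
Local Notation XB := (quot_module killed).
Local Open Scope quotient_scope.

HB.instance Definition _ := GRing.Zmodule.on XB.

Definition quot_scale (b : B^c) (x : XB) : XB :=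
  (repr (b : B) : A^c) *: (x : X).

Lemma quot_scaleE (a : A) (x : XB) :
  quot_scale (\pi_B a) x = (a : A^c) *: (x : X).
Proof.
apply/eqP; rewrite -subr_eq0 -scalerBl; apply/eqP.
exact/killed/quot_repr_sub.
Qed.

Lemma quot_scaleA a b x : quot_scale a (quot_scale b x) = quot_scale (a * b) x.
Proof.
elim/quotW: a => a; elim/quotW: b => b.
rewrite (quot_scaleE b) (quot_scaleE a) (scalerA (a : A^c)).
by rewrite -(quot_scaleE (b * a)) -(quot_pi_mul I b a).
Qed.

Lemma quot_scale1 : left_id 1 quot_scale.
Proof. by move=> x; rewrite (quot_scaleE 1) (scale1r (x : X)). Qed.

Lemma quot_scaleDr : right_distributive quot_scale +%R.
Proof. by move=> b x y; rewrite /quot_scale scalerDr. Qed.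

Lemma quot_scaleDl x : {morph quot_scale^~ x : a b / a + b}.
Proof.
elim/quotW=> a; elim/quotW=> b; rewrite (quot_scaleE a) (quot_scaleE b).
by rewrite -(scalerDl (x : X) (a : A^c)) -(quot_scaleE (a + b)) -(quot_pi_add I a).
Qed.

HB.instance Definition _ := GRing.Zmodule_isLmodule.Build B^c XB
  quot_scaleA quot_scale1 quot_scaleDr quot_scaleDl.

End QuotientModule.

Section Annihilator.
Variables (A : pzRingType) (U : lmodType A^c -> Prop).

Definition Ann (a : A) : bool :=
  `[< forall X : lmodType A^c, U X -> forall x : X, (a : A^c) *: x = 0 >].

Lemma Ann_zmod_closed : zmod_closed Ann.
Proof.
split=> [|a b /asboolP Ia /asboolP Ib]; apply/asboolP => X UX x.
  exact: scale0r.
by rewrite (scalerBl (a : A^c)) Ia // Ib // subr0.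
Qed.

Lemma Ann_mull (a x : A) : x \in (Ann : {pred A}) -> a * x \in (Ann : {pred A}).
Proof.
move=> /asboolP Ix; apply/asboolP => X UX y.
by rewrite -(scalerA (x : A^c) (a : A^c)) Ix.
Qed.

Lemma Ann_mulr (a x : A) : x \in (Ann : {pred A}) -> x * a \in (Ann : {pred A}).
Proof.
move=> /asboolP Ix; apply/asboolP => X UX y.
by rewrite -(scalerA (a : A^c) (x : A^c)) Ix // scaler0.
Qed.

HB.instance Definition _ := GRing.isZmodClosed.Build A Ann Ann_zmod_closed.
HB.instance Definition _ := isTwoSidedIdeal.Build A Ann Ann_mull Ann_mulr.

Lemma Ann_killed (X : lmodType A^c) : U X ->
  forall a : A^c, a \in (Ann : {pred A}) -> forall x : X, a *: x = 0.
Proof. by move=> UX a /asboolP Ia x; apply: Ia. Qed.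

(* An object of U as a right module over A / Ann U. *)
Definition Ann_module (X : lmodType A^c) (UX : U X) :
    lmodType (quot_ring Ann)^c :=
  quot_module (Ann_killed UX).

End Annihilator.

(* Main.v *)
From HB Require Import structures.
Require Import Defs.
From mathcomp Require Import all_boot all_order all_algebra all_field.
From mathcomp Require Import generic_quotient ring_quotient.
From mathcomp Require Import boolp classical_sets zify.

Set Implicit Arguments.
Unset Strict Implicit.
Unset Printing Implicit Defensive.

Import GRing.Theory.
Local Open Scope ring_scope.

(** Write T for the given generator, B for A / Ann U, DA for Hom_k(A, k), and
    tr N for the largest submodule of N generated by U. For N in M the module
    tr N lies in U, and the exactness required of a d-torsion class amounts to
    Ext^i(X, N / tr N) = 0 for X in U and 0 <= i < d ([perp_in]). The whole proof
    rests on this vanishing.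

    Projective dimension and rigidity. By duality tr DA is the set of functionals
    that vanish on Ann U: it is the injective cogenerator DB of mod B, so DB is in
    U. As DA is injective, the vanishing above gives Ext_A^i(X, DB) = 0 for X in U
    and 0 < i <= d ([U_cogenerator]); computing with coresolutions by powers of
    DB, one sees that vanishing of Ext_A^i(X, -) implies vanishing of
    Ext_B^i(X, -) for 0 < i <= d ([Ext_Ann_module]). This settles Ext_B^i(T, T)
    for i <= d. Next, Ext_A^d(T, Y) = 0 for every Y generated by U and not only
    for Y in U: a left M-approximation of Y takes its values in U, and its
    cokernel has smaller M-codimension than Y ([Ext_projective_generated]). Since
    any Y in mod B embeds in a power of DB with a cokernel generated by U,
    Ext_B^(d+1)(T, Y) = 0 by dimension shift, whence pd T <= d.

    Coresolution. Take a minimal left U-approximation of A, then one of its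
    cokernel C_1, and so on. The kernel of the first map is Ann U. The later ones
    are injective and are left M-approximations, because C_j is generated by U;
    so C_d is in M, and being generated by U it is in U. It remains to see that a
    minimal left U-approximation C_j -> X has an Ext^d-projective target
    ([minimal_Ext_projective]). For V in U, Ext^d(-, V) is on U the cokernel of
    Hom(-, W) -> Hom(-, Z) for a suitable epimorphism W -> Z of objects of U
    ([Ext_presented_in]). Given X -> Z, the map C_j -> X -> Z lifts to W, so C_j
    maps to the pullback E of X and W over Z. If C_j -> E factors through an
    object of U, then it factors through X by the approximation property; the
    composite X -> E -> X fixes the approximation, is invertible by minimality,
    and X -> Z lifts to W.

    That factorization is clear for the projective module A when E is generated
    by U; for the later C_j it needs a finite resolution of E by objects of U, all
    of whose maps are right U-approximations ([U_resolved_perp]). Here is its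
    source. The pullback satisfies Ext^i(E, N / tr N) = 0 for all N in M and i < d,
    and has a resolution N_. of length d by right M-approximations. The vanishing
    makes any chain map from a projective resolution of E to N_. / tr N_.
    null-homotopic, so that tr N_0 -> E is onto ([cocycle_trace]), and the argument
    repeats on the kernel. *)

(** * Submodules, quotients and short exact sequences *)

Record submodule_pred (R : pzRingType) (X : lmodType R) (S : X -> Prop) : Prop :=
  SubmodulePred {
    sub_zero : S 0;
    sub_add : forall x y, S x -> S y -> S (x + y);
    sub_scale : forall a x, S x -> S (a *: x) }.

Section SubQuotient.
Variables (R : pzRingType) (X : lmodType R) (S : X -> Prop).
Hypothesis clS : submodule_pred S.

Let inS (x : X) : bool := `[< S x >].

Lemma sub_opp x : S x -> S (- x).
Proof. by rewrite -scaleN1r; apply: sub_scale. Qed.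

Lemma sub_diff x y : S x -> S y -> S (x - y).
Proof. by move=> Sx Sy; apply: sub_add => //; apply: sub_opp. Qed.

Let inS_closed : GRing.subsemimod_closed inS.
Proof.
split=> [|a x /asboolP Sx]; last by apply/asboolP; apply: sub_scale.
split; first by apply/asboolP; apply: sub_zero.
by move=> x y /asboolP Sx /asboolP Sy; apply/asboolP; apply: sub_add.
Qed.

Definition submodule of submodule_pred S : Type := {x : X | inS x}.
Local Notation subX := (submodule clS).
HB.instance Definition _ := [isSub of subX for sval].
HB.instance Definition _ := [Choice of subX by <:].
HB.instance Definition _ := GRing.SubChoice_isSubLmodule.Build R X inS subX inS_closed.

Let inS_zmod : zmod_closed inS.
Proof.
split; first by apply/asboolP; apply: sub_zero.
by move=> x y /asboolP Sx /asboolP Sy; apply/asboolP; apply: sub_diff.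
Qed.
Definition zmod_pred : zmodClosed X :=
  HB.pack inS (GRing.isZmodClosed.Build X inS inS_zmod).
Definition quotmodule : Type := Quotient.quot zmod_pred.
Local Notation Q := quotmodule.
Local Open Scope quotient_scope.

HB.instance Definition _ := GRing.Zmodule.on Q.
HB.instance Definition _ := Quotient.on Q.

Lemma quotmodule_eqP (a b : X) : \pi_Q a = \pi_Q b <-> S (a - b).
Proof.
split=> [/eqP|/asboolP Sab]; last first.
  by apply/eqP; rewrite -[_ == _](@Quotient.idealrBE X zmod_pred).
by rewrite -[_ == _](@Quotient.idealrBE X zmod_pred) => /asboolP.
Qed.

Lemma quotmoduleD (a b : X) : \pi_Q (a + b) = \pi_Q a + \pi_Q b.
Proof. exact: (@Quotient.pi_add _ zmod_pred). Qed.

Definition quotmodule_scale (c : R) (x : Q) : Q := \pi_Q (c *: repr x).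

Lemma quotmodule_scaleE c (x : X) : quotmodule_scale c (\pi_Q x) = \pi_Q (c *: x).
Proof.
apply/quotmodule_eqP; rewrite -scalerBr; apply: sub_scale => //.
by apply: (quotmodule_eqP _ _).1; rewrite reprK.
Qed.

Lemma quotmodule_scaleA a b x :
  quotmodule_scale a (quotmodule_scale b x) = quotmodule_scale (a * b) x.
Proof.
elim/quotW: x => x.
by rewrite (quotmodule_scaleE b x) (quotmodule_scaleE a (b *: x))
  (quotmodule_scaleE (a * b) x) scalerA.
Qed.

Lemma quotmodule_scale1 : left_id 1 quotmodule_scale.
Proof. by elim/quotW=> x; rewrite (quotmodule_scaleE 1 x) scale1r. Qed.

Lemma quotmodule_scaleDr : right_distributive quotmodule_scale +%R.
Proof.
move=> a; elim/quotW=> x; elim/quotW=> y.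
by rewrite -(quotmoduleD x y) (quotmodule_scaleE a (x + y)) (quotmodule_scaleE a x)
  (quotmodule_scaleE a y) scalerDr quotmoduleD.
Qed.

Lemma quotmodule_scaleDl x : {morph quotmodule_scale^~ x : a b / a + b}.
Proof.
elim/quotW: x => x a b.
by rewrite (quotmodule_scaleE (a + b) x) (quotmodule_scaleE a x) (quotmodule_scaleE b x)
  scalerDl quotmoduleD.
Qed.

HB.instance Definition _ := GRing.Zmodule_isLmodule.Build R Q
  quotmodule_scaleA quotmodule_scale1 quotmodule_scaleDr quotmodule_scaleDl.

End SubQuotient.

Section Diagrams.
Variable R : pzRingType.
Implicit Types X Y Z W K : lmodType R.

Lemma linear_of_fun X Y (f : X -> Y) : linear f -> exists h : {linear X -> Y}, h =1 f.
Proof.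
move=> lf; pose h : {linear X -> Y} :=
  HB.pack f (GRing.isLinear.Build R X Y *:%R f lf).
by exists h.
Qed.

(** Lifts, descents and extensions of linear maps are all found by describing
    their graph. *)
Lemma linear_of_rel X Y (G : X -> Y -> Prop) :
    (forall x, exists y, G x y) -> (forall x y y', G x y -> G x y' -> y = y') ->
    (forall a x x' y y', G x y -> G x' y' -> G (a *: x + x') (a *: y + y')) ->
  exists h : {linear X -> Y}, forall x, G x (h x).
Proof.
move=> /choice[f Gf] Gfun Glin.
have [|h hE] := @linear_of_fun X Y f.
  by move=> a x y; apply: (Gfun (a *: x + y)) => //; apply: Glin.
by exists h => x; rewrite hE.
Qed.

Definition ses X Y Z (i : {linear X -> Y}) (p : {linear Y -> Z}) : Prop :=
  [/\ injective i, exact i p & surjection p].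

Lemma lift_through X Y Z (i : {linear Y -> Z}) (f : {linear X -> Z}) :
    injective i -> (forall x, exists y, i y = f x) ->
  exists h : {linear X -> Y}, forall x, i (h x) = f x.
Proof.
move=> inj_i fi.
apply: (@linear_of_rel X Y (fun x y => i y = f x)) => // [x y y' <- /inj_i //|].
by move=> a x x' y y' eq1 eq2; rewrite !linearP eq1 eq2.
Qed.

Lemma descend X Y Z (p : {linear X -> Y}) (f : {linear X -> Z}) :
    surjection p -> (forall x, p x = 0 -> f x = 0) ->
  exists h : {linear Y -> Z}, forall x, h (p x) = f x.
Proof.
move=> sp fp.
have [|||h hE] := @linear_of_rel Y Z (fun y z => exists2 x, p x = y & f x = z).
- by move=> y; have [x <-] := sp y; exists (f x), x.
- move=> y z z' [x px <-] [x' px' <-]; apply/eqP; rewrite -subr_eq0 -linearB.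
  by rewrite fp // linearB px px' subrr.
- move=> a y y' z z' [x <- <-] [x' <- <-].
  by exists (a *: x + x'); rewrite linearP.
exists h => x; have [x' pE <-] := hE (p x); apply/eqP.
by rewrite -subr_eq0 -linearB fp // linearB pE subrr.
Qed.

Lemma injP X Y (f : {linear X -> Y}) : (forall x, f x = 0 -> x = 0) -> injective f.
Proof.
move=> f0 x y eqf; apply/eqP; rewrite -subr_eq0; apply/eqP/f0.
by rewrite linearB eqf subrr.
Qed.

Lemma inj0 X Y (f : {linear X -> Y}) x : injective f -> f x = 0 -> x = 0.
Proof. by move=> inj fx; apply: inj; rewrite fx linear0. Qed.

Lemma submodule_ex X (S : X -> Prop) : submodule_pred S ->
  exists K (i : {linear K -> X}),
    injective i /\ forall x, S x <-> exists y, i y = x.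
Proof.
move=> clS; exists (submodule clS : lmodType R), (val : {linear _ -> _}).
split=> [|x]; first exact: val_inj.
split=> [Sx|[y <-]]; last exact/asboolP/(valP y).
by exists (exist _ x (asboolT Sx)).
Qed.

Lemma quotient_ex X (S : X -> Prop) : submodule_pred S ->
  exists (Q : lmodType R) (p : {linear X -> Q}), surjection p /\ forall x, p x = 0 <-> S x.
Proof.
move=> clS; pose Q : lmodType R := quotmodule clS.
have [|p pE] := @linear_of_fun X Q (\pi_(quotmodule clS))%qT.
  move=> a x y; rewrite quotmoduleD -(quotmodule_scaleE clS).
  by [].
exists Q, p; split=> [|x].
  by elim/quotW=> x; exists x; rewrite pE.
rewrite -[S x]/(S x) -{2}[x]subr0 -(quotmodule_eqP clS) pE.
suff -> : (\pi_(quotmodule clS) (0 : X))%qT = 0 by [].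
by rewrite -[LHS]pE linear0.
Qed.

Lemma submodule_ker X Y (f : {linear X -> Y}) : submodule_pred (fun x => f x = 0).
Proof.
by split=> [|x y fx fy|a x fx]; rewrite ?linear0 ?linearD ?linearZ /= ?fx ?fy
  ?addr0 ?scaler0.
Qed.

Lemma submodule_im X Y (f : {linear X -> Y}) :
  submodule_pred (fun y => exists x, f x = y).
Proof.
split=> [|_ _ [x <-] [y <-]|a _ [x <-]]; first by exists 0; rewrite linear0.
  by exists (x + y); rewrite linearD.
by exists (a *: x); rewrite linearZ.
Qed.

Lemma ses_ker X Y (p : {linear X -> Y}) : surjection p ->
  exists K (i : {linear K -> X}), ses i p.
Proof.
by move=> sp; have [K [i [inj_i iE]]] := submodule_ex (submodule_ker p); exists K, i.
Qed.

Lemma ses_coker X Y (i : {linear X -> Y}) : injective i ->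
  exists (Q : lmodType R) (p : {linear Y -> Q}), ses i p.
Proof.
by move=> inj_i; have [Q [p [sp pE]]] := quotient_ex (submodule_im i); exists Q, p.
Qed.

Lemma ses0 X Y Z (i : {linear X -> Y}) (p : {linear Y -> Z}) x :
  ses i p -> p (i x) = 0.
Proof. by case=> _ ex _; apply/ex; exists x. Qed.

Lemma ses_lift X Y Z W (i : {linear X -> Y}) (p : {linear Y -> Z}) (f : {linear W -> Y}) :
  ses i p -> (forall w, p (f w) = 0) ->
  exists h : {linear W -> X}, forall w, i (h w) = f w.
Proof.
by case=> inj ex _ pf; apply: lift_through => // w; apply/ex/pf.
Qed.

Lemma ses_desc X Y Z W (i : {linear X -> Y}) (p : {linear Y -> Z}) (f : {linear Y -> W}) :
  ses i p -> (forall x, f (i x) = 0) ->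
  exists h : {linear Z -> W}, forall y, h (p y) = f y.
Proof.
by case=> _ ex sp fi; apply: descend => // y /ex[x <-].
Qed.

Lemma isomodP X Y (f : {linear X -> Y}) : injective f -> surjection f -> isomod X Y.
Proof.
move=> inj_f sf; exists f; have /choice[g fg] := sf.
by exists g => // x; apply: inj_f.
Qed.

Lemma isomod_sym X Y : isomod X Y -> isomod Y X.
Proof.
case=> f [g fK gK]; have [|h hE] := @linear_of_fun Y X g.
  by move=> a x y; apply: (can_inj fK); rewrite linearP !gK.
exists h; exists f => x; [by rewrite hE gK | by rewrite hE fK].
Qed.

End Diagrams.

(** * Vanishing of Ext along short exact sequences *)

Section SecondVariable.
Variable R : pzRingType.
Implicit Types X Y Z W K : lmodType R.

(** Vanishing of Ext computed with one given resolution. Long exact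
    sequences in the second variable are cocycle manipulations on a fixed
    resolution. In degree 0 the condition says Hom(X, Y) = 0, which lets these
    sequences be used uniformly in all degrees. *)
Definition Ext_at X (P : proj_resolution X) n Y : Prop :=
  forall f : {linear P n -> Y}, cocycle f -> coboundary f.

Lemma res_kerS X (P : proj_resolution X) n y :
  res_diff P n y = 0 <-> exists x, res_diff P n.+1 x = y.
Proof. exact: res_exactS. Qed.

Lemma res_ker0 X (P : proj_resolution X) y :
  res_aug P y = 0 <-> exists x, res_diff P 0 x = y.
Proof. exact: res_exact0. Qed.

Lemma res_dd X (P : proj_resolution X) n x :
  res_diff P n (res_diff P n.+1 x) = 0.
Proof. by apply/res_kerS; exists x. Qed.

Lemma res_augd X (P : proj_resolution X) x : res_aug P (res_diff P 0 x) = 0.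
Proof. by apply/res_ker0; exists x. Qed.

Variables (Y W Z : lmodType R) (i : {linear Y -> W}) (p : {linear W -> Z}).
Hypothesis sip : ses i p.

Let inj_i : injective i. Proof. by case: sip. Qed.
Let surj_p : surjection p. Proof. by case: sip. Qed.

Lemma Ext_at_quotient X (P : proj_resolution X) n :
  Ext_at P n W -> Ext_at P n.+1 Y -> Ext_at P n Z.
Proof.
move=> EW EY f cf; have [g gE] := res_proj f surj_p.
have [x|c cE] := ses_lift (f := g \o res_diff P n) sip; first by rewrite /= gE cf.
have [x|e eE] := EY c.
  by apply: inj_i; rewrite cE /= res_dd !linear0.
have /EW : cocycle (g \- (i \o e) : {linear P n -> W}).
  by move=> x; rewrite /= -eE cE /= subrr.
have fE x : f x = p ((g \- (i \o e)) x) by rewrite /= linearB gE (ses0 _ sip) subr0.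
case: n f g c e {cf gE cE EY eE EW} fE => [|n] f g c e fE /=.
  by move=> g0 x; rewrite fE /= g0 linear0.
by case=> h hE; exists (p \o h) => x; rewrite fE /= hE.
Qed.

Lemma Ext_at_submodule X (P : proj_resolution X) n :
  Ext_at P n Z -> Ext_at P n.+1 W -> Ext_at P n.+1 Y.
Proof.
move=> EZ EW f cf.
have [x|g gE] := EW (i \o f); first by rewrite /= cf linear0.
have cpg : cocycle (p \o g : {linear P n -> Z}).
  by move=> x; rewrite /= -gE /= (ses0 _ sip).
suff [g' pg' g'd] : exists2 g' : {linear P n -> W}, forall x, p (g' x) = 0 &
    forall x, g' (res_diff P n x) = g (res_diff P n x).
  have [e eE] := ses_lift sip pg'.
  by exists e => x; apply: inj_i; rewrite eE g'd -gE.
case: n f g {cf gE EW} EZ cpg => [|n] f g EZ /EZ /=; first by exists g.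
case=> h hE; have [h' h'E] := res_proj h surj_p.
exists (g \- (h' \o res_diff P n)) => x /=; last by rewrite res_dd linear0 subr0.
by rewrite linearB h'E -hE subrr.
Qed.

(** The degree 0 to 1 step, where a vanishing hypothesis on Hom(X, Z) would be too
    strong: surjectivity of Hom(X, W) -> Hom(X, Z) is what matters. *)
Lemma Ext_at1_submodule X (P : proj_resolution X) :
    (forall h : {linear X -> Z}, exists k : {linear X -> W}, forall x, p (k x) = h x) ->
  Ext_at P 1 W -> Ext_at P 1 Y.
Proof.
move=> liftZ EW f cf.
have [x|g gE] := EW (i \o f); first by rewrite /= cf linear0.
have [x /res_ker0[y <-]|h hE] := descend (f := p \o g) (res_surj P).
  by rewrite /= -gE /= (ses0 _ sip).
have [k kE] := liftZ h.
have [x|e eE] := ses_lift (f := g \- (k \o res_aug P)) sip.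
  by rewrite /= linearB kE hE subrr.
by exists e => x; apply: inj_i; rewrite eE /= res_augd linear0 subr0 -gE.
Qed.

Lemma Ext_at1_lift X (P : proj_resolution X) (h : {linear X -> Z}) :
  Ext_at P 1 Y -> exists k : {linear X -> W}, forall x, p (k x) = h x.
Proof.
move=> EY; have [g gE] := res_proj (h \o res_aug P) surj_p.
have [x|c cE] := ses_lift (f := g \o res_diff P 0) sip.
  by rewrite /= gE /= res_augd linear0.
have [x|e eE] := EY c.
  by apply: inj_i; rewrite cE /= res_dd !linear0.
have [x /res_ker0[y <-]|k kE] := descend (f := g \- (i \o e)) (res_surj P).
  by rewrite /= -eE cE /= subrr.
exists k => x; have [y <-] := res_surj P x.
by rewrite kE /= linearB (ses0 _ sip) subr0 gE.
Qed.

End SecondVariable.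

Section Homological.
Variable R : pzRingType.
Implicit Types X Y Z W K I : lmodType R.

(** Injectivity is tested on all modules, since the projective modules occurring
    in a resolution need not be finitely generated. *)
Definition injective_module I : Prop :=
  forall X Y (i : {linear X -> Y}) (f : {linear X -> I}), injective i ->
  exists h : {linear Y -> I}, forall x, h (i x) = f x.

Lemma injective_extend I X Y (g : {linear X -> Y}) (f : {linear X -> I}) :
    injective_module I -> (forall x, g x = 0 -> f x = 0) ->
  exists h : {linear Y -> I}, forall x, h (g x) = f x.
Proof.
move=> injI fg; have [K [i [inj_i iE]]] := submodule_ex (submodule_im g).
have [x|q qE] := lift_through (f := g) inj_i; first by apply/iE; exists x.
have [y|x qx|h hE] := descend (p := q) (f := f).
- have /iE[x gx] : exists z, i z = i y by exists y.
  by exists x; apply: inj_i; rewrite qE.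
- by apply: fg; rewrite -qE qx linear0.
have [e eE] := injI _ _ _ h inj_i; exists e => x.
by rewrite -qE eE hE.
Qed.

Lemma Ext_at_injective X (P : proj_resolution X) n I :
  injective_module I -> Ext_at P n.+1 I.
Proof.
move=> injI f cf; have [x|h hE] := injective_extend (g := res_diff P n) (f := f) injI.
  by move/res_kerS => [y <-]; apply: cf.
by exists h.
Qed.

Lemma Ext_injective n X I : injective_module I -> Ext_eq0 n.+1 X I.
Proof. by move=> injI P; apply: Ext_at_injective. Qed.

Definition noetherian : Prop :=
  forall X Y (i : {linear X -> Y}), injective i -> fgmod Y -> fgmod X.

Definition enough_injectives : Prop :=
  forall Y, fgmod Y -> exists (I Z : lmodType R) (i : {linear Y -> I}) (p : {linear I -> Z}),
    [/\ ses i p, injective_module I, fgmod I & fgmod Z].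

Lemma fgmod_surj X Y (p : {linear X -> Y}) : surjection p -> fgmod X -> fgmod Y.
Proof.
move=> sp [n [e gen]]; exists n, (p \o e) => y; have [x <-] := sp y.
have [c ->] := gen x; exists c; rewrite linear_sum.
by apply: eq_bigr => j _; rewrite linearZ.
Qed.

Lemma projective_free n : projective ({ffun 'I_n -> R^o} : lmodType R).
Proof.
move=> Y Z g f sg; pose b j : {ffun 'I_n -> R^o} := [ffun j' => (j' == j)%:R].
have /choice[e eE] : forall j, exists y, g y = f (b j) by move=> j; apply: sg.
have [|h hE] := @linear_of_fun R {ffun 'I_n -> R^o} Y (fun c => \sum_j (c j : R) *: e j).
  move=> a c c'; rewrite scaler_sumr -big_split /=; apply: eq_bigr => j _.
  by rewrite !ffunE scalerDl scalerA.
exists h => c; rewrite hE linear_sum /=.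
have {2}-> : c = \sum_j (c j : R) *: b j.
  apply/ffunP=> j; rewrite sum_ffunE (bigD1 j) //= !ffunE eqxx.
  rewrite big1 ?addr0 => [|j' ne]; last by rewrite !ffunE eq_sym (negbTE ne) [LHS]mulr0.
  by rewrite [RHS]mulr1.
by rewrite linear_sum; apply: eq_bigr => j _; rewrite !linearZ eE.
Qed.

Lemma fgmod_free n : fgmod ({ffun 'I_n -> R^o} : lmodType R).
Proof.
exists n, (fun j => [ffun j' => (j' == j)%:R]) => c; exists c.
apply/ffunP=> j; rewrite sum_ffunE (bigD1 j) //= !ffunE eqxx.
rewrite big1 ?addr0 => [|j' ne]; last by rewrite !ffunE eq_sym (negbTE ne) [LHS]mulr0.
by rewrite [RHS]mulr1.
Qed.

Lemma free_cover X : fgmod X ->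
  exists n (p : {linear {ffun 'I_n -> R^o} -> X}), surjection p.
Proof.
move=> [n [e gen]]; exists n.
have [|h hE] := @linear_of_fun R {ffun 'I_n -> R^o} X (fun c => \sum_j (c j : R) *: e j).
  move=> a c c'; rewrite scaler_sumr -big_split /=; apply: eq_bigr => j _.
  by rewrite !ffunE scalerDl scalerA.
exists h => x; have [c ->] := gen x; exists [ffun j => c j].
by rewrite hE; apply: eq_bigr => j _; rewrite ffunE.
Qed.

Hypothesis noethR : noetherian.

Lemma syzygy_ex X : fgmod X ->
  exists (K P : lmodType R) (i : {linear K -> P}) (p : {linear P -> X}),
  [/\ ses i p, projective P, fgmod P & fgmod K].
Proof.
move=> fgX; have [n [p sp]] := free_cover fgX.
have [K [i sip]] := ses_ker sp; exists K, _, i, p.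
split=> //; [exact: projective_free|exact: fgmod_free|].
by have [inj_i _ _] := sip; apply: noethR inj_i (fgmod_free n).
Qed.

(** One step of a resolution; bundling it makes the resolution an iteration on
    finitely generated modules, without dependent recursion. *)
Record syzygy X := Syzygy {
  syz_ker : lmodType R;
  syz_cover : lmodType R;
  syz_inc : {linear syz_ker -> syz_cover};
  syz_map : {linear syz_cover -> X};
  syz_ses : ses syz_inc syz_map;
  syz_proj : projective syz_cover;
  syz_fg : fgmod syz_ker }.

Lemma resolution_ex X : fgmod X -> exists P : proj_resolution X, True.
Proof.
move=> fgX.
have syz (s : {K | fgmod K}) : syzygy (sval s).
  have /cid[c _] : exists c : syzygy (sval s), True; last exact: c.
  have [K [P [i [p [sip prP _ fgK]]]]] := syzygy_ex (svalP s).
  by exists (Syzygy sip prP fgK).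
pose next s : {K | fgmod K} := exist _ _ (syz_fg (syz s)).
pose st n := iter n next (exist _ X fgX).
pose P n := syz_cover (syz (st n)).
pose a n : {linear P n -> sval (st n)} := syz_map (syz (st n)).
pose j n : {linear sval (st n.+1) -> P n} := syz_inc (syz (st n)).
have sja n : ses (j n) (a n) by exact: syz_ses.
unshelve eexists (@ProjResolution R X P (fun n => j n \o a n.+1) (a 0%N) _ _ _ _).
- by move=> n; apply: syz_proj.
- by case: (sja 0%N).
- move=> y; have [_ ex _] := sja 0%N; rewrite ex; have [_ _ sa] := sja 1%N.
  by split=> [[x <-]|[x <-]]; [have [z <-] := sa x; exists z|exists (a 1%N x)].
- move=> n y /=; have [_ ex _] := sja n.+1; have [_ _ sa] := sja n.+2.
  have [inj _ _] := sja n; split=> [/(inj0 inj)/ex[x <-]|[x <-]].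
    by have [z <-] := sa x; exists z.
  by rewrite /= (ses0 _ (sja n.+1)) linear0.
- by [].
Qed.

Lemma Ext0P X Y : fgmod X ->
  Ext_eq0 0 X Y <-> forall (h : {linear X -> Y}) x, h x = 0.
Proof.
move=> fgX; split=> [E h x|E P f cf].
  have [P _] := resolution_ex fgX; have [y <-] := res_surj P x.
  have /E : cocycle (h \o res_aug P : {linear P 0%N -> Y}); last exact.
  by move=> z /=; rewrite res_augd linear0.
have [x /res_ker0[y <-]|h hE] := descend (f := f) (res_surj P); first exact: cf.
by move=> x; rewrite -hE E.
Qed.

Section Sequence2.
Variables (Y W Z : lmodType R) (i : {linear Y -> W}) (p : {linear W -> Z}).
Hypothesis sip : ses i p.

Lemma Ext_quotient n X : Ext_eq0 n X W -> Ext_eq0 n.+1 X Y -> Ext_eq0 n X Z.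
Proof. by move=> EW EY P; apply: Ext_at_quotient sip _ _ _ (EW P) (EY P). Qed.

Lemma Ext_submodule n X : Ext_eq0 n X Z -> Ext_eq0 n.+1 X W -> Ext_eq0 n.+1 X Y.
Proof. by move=> EZ EW P; apply: Ext_at_submodule sip _ _ _ (EZ P) (EW P). Qed.

Lemma Ext1_submodule X :
    (forall h : {linear X -> Z}, exists k : {linear X -> W}, forall x, p (k x) = h x) ->
  Ext_eq0 1 X W -> Ext_eq0 1 X Y.
Proof. by move=> lZ EW P; apply: Ext_at1_submodule sip _ _ lZ (EW P). Qed.

Lemma Ext1_lift X (h : {linear X -> Z}) : fgmod X ->
  Ext_eq0 1 X Y -> exists k : {linear X -> W}, forall x, p (k x) = h x.
Proof.
by move=> /resolution_ex[P _] EY; apply: Ext_at1_lift sip _ _ _ (EY P).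
Qed.

End Sequence2.

(** Long exact sequences in the first variable. Embedding the second variable Y in
    an injective I lowers the degree by one, so everything reduces to lifting maps
    to I / Y along I -> I / Y. *)
Section Sequence1.
Hypothesis enough : enough_injectives.
Variables (C W D : lmodType R) (i : {linear C -> W}) (p : {linear W -> D}).
Hypotheses (sip : ses i p) (fgC : fgmod C) (fgW : fgmod W).

Let inj_i : injective i. Proof. by case: sip. Qed.
Let fgD : fgmod D. Proof. by have [_ _ sp] := sip; apply: fgmod_surj sp fgW. Qed.

Lemma Ext1_extend Y (h : {linear C -> Y}) : fgmod Y ->
  Ext_eq0 1 D Y -> exists k : {linear W -> Y}, forall x, k (i x) = h x.
Proof.
move=> /enough[I [Z [j [q [sjq injI _ _]]]]] ED.
have [g gE] := injI _ _ i (j \o h) inj_i.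
have [x|c cE] := ses_desc (f := q \o g) sip; first by rewrite /= gE /= (ses0 _ sjq).
have [c' c'E] := Ext1_lift sjq c fgD ED.
have [x|k kE] := ses_lift (f := g \- (c' \o p)) sjq.
  by rewrite /= linearB c'E cE subrr.
exists k => x; have [inj_j _ _] := sjq; apply: inj_j.
by rewrite kE /= (ses0 _ sip) linear0 subr0 gE.
Qed.

Lemma Ext1_coker Y : fgmod Y ->
    (forall h : {linear C -> Y}, exists k : {linear W -> Y}, forall x, k (i x) = h x) ->
  Ext_eq0 1 W Y -> Ext_eq0 1 D Y.
Proof.
move=> /enough[I [Z [j [q [sjq injI _ _]]]]] ext EW.
apply: (Ext1_submodule sjq _ (Ext_injective injI)) => h.
have [k kE] := Ext1_lift sjq (h \o p) fgW EW.
have [x|g gE] := ses_lift (f := k \o i) sjq.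
  by rewrite /= kE /= (ses0 _ sip) linear0.
have [e eE] := ext g.
have [x|c cE] := ses_desc (f := k \- (j \o e)) sip.
  by rewrite /= eE gE subrr.
exists c => y; have [_ _ sp] := sip; have [w <-] := sp y.
by rewrite cE /= linearB (ses0 _ sjq) subr0 kE.
Qed.

Lemma Ext_extension n Y : fgmod Y -> Ext_eq0 n C Y -> Ext_eq0 n D Y -> Ext_eq0 n W Y.
Proof.
case: n => [|n] fgY.
  move=> /(Ext0P _ fgC) EC /(Ext0P _ fgD) ED; apply/(Ext0P _ fgW) => h x.
  have [x'|g gE] := ses_desc (f := h) sip; first exact: (EC (h \o i)).
  by rewrite -gE ED.
elim: n Y fgY => [|n IHn] Y fgY EC ED;
    have [I [Z [j [q [sjq injI fgI fgZ]]]]] := enough fgY.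
  apply: (Ext1_submodule sjq _ (Ext_injective injI)) => h.
  have [g gE] := Ext1_lift sjq (h \o i) fgC EC.
  have [e eE] := injI _ _ i g inj_i.
  have [x|c cE] := ses_desc (f := h \- (q \o e)) sip.
    by rewrite /= eE gE subrr.
  have [k kE] := Ext1_lift sjq c fgD ED.
  by exists (e \+ (k \o p)) => x; rewrite /= linearD kE cE /= addrC subrK.
apply: (Ext_submodule sjq _ (Ext_injective injI)); apply: IHn => //.
  exact: (Ext_quotient sjq) (Ext_injective injI) EC.
exact: (Ext_quotient sjq) (Ext_injective injI) ED.
Qed.

Lemma Ext_coker n Y : fgmod Y ->
  Ext_eq0 n C Y -> Ext_eq0 n.+1 W Y -> Ext_eq0 n.+1 D Y.
Proof.
case: n => [|n] fgY.
  move=> /(Ext0P _ fgC) EC; apply: Ext1_coker => // h.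
  by exists \0 => x; rewrite EC.
elim: n Y fgY => [|n IHn] Y fgY EC EW;
    have [I [Z [j [q [sjq injI fgI fgZ]]]]] := enough fgY;
    apply: (Ext_submodule sjq _ (Ext_injective injI)).
  apply: Ext1_coker => // [h|]; last exact: (Ext_quotient sjq) (Ext_injective injI) EW.
  have [g gE] := Ext1_lift sjq h fgC EC.
  have [e eE] := injI _ _ i g inj_i.
  by exists (q \o e) => x; rewrite /= eE gE.
apply: IHn => //; first exact: (Ext_quotient sjq) (Ext_injective injI) EC.
exact: (Ext_quotient sjq) (Ext_injective injI) EW.
Qed.

Lemma Ext_ker n Y : fgmod Y ->
  Ext_eq0 n W Y -> Ext_eq0 n.+1 D Y -> Ext_eq0 n C Y.
Proof.
case: n => [|n] fgY.
  move=> /(Ext0P _ fgW) EW ED; apply/(Ext0P _ fgC) => h x.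
  by have [k <-] := Ext1_extend h fgY ED; rewrite EW.
elim: n Y fgY => [|n IHn] Y fgY EW ED;
    have [I [Z [j [q [sjq injI fgI fgZ]]]]] := enough fgY.
  apply: (Ext1_submodule sjq _ (Ext_injective injI)) => h.
  have ED' := Ext_quotient sjq (Ext_injective injI) ED.
  have [k kE] := Ext1_extend h fgZ ED'.
  have [g gE] := Ext1_lift sjq k fgW EW.
  by exists (g \o i) => x; rewrite /= gE kE.
apply: (Ext_submodule sjq _ (Ext_injective injI)); apply: IHn => //.
  exact: (Ext_quotient sjq) (Ext_injective injI) EW.
exact: (Ext_quotient sjq) (Ext_injective injI) ED.
Qed.

End Sequence1.

Lemma Ext_projective_eq0 n X Y :
  enough_injectives -> projective X -> fgmod Y -> Ext_eq0 n.+1 X Y.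
Proof.
move=> enough prX; elim: n Y => [|n IHn] Y fgY;
    have [I [Z [j [q [sjq injI fgI fgZ]]]]] := enough _ fgY.
  apply: (Ext1_submodule sjq _ (Ext_injective injI)) => h.
  by have [_ _ sq] := sjq; apply: prX sq.
by apply: (Ext_submodule sjq _ (Ext_injective injI)); apply: IHn.
Qed.

Lemma zeromod_projective X : zeromod X -> projective X.
Proof. by move=> X0 Y Z g f _; exists \0 => x; rewrite (X0 x) !linear0. Qed.

Lemma zero_ex : exists Z : lmodType R, zeromod Z.
Proof. by exists ('rV[R]_0 : lmodType R) => x; apply/rowP; case. Qed.

Lemma pd_le0 X : projective X -> pd_le 0 X.
Proof.
move=> prX; have [Z Z0] := zero_ex.
pose P n : lmodType R := if n is 0 then X else Z.
pose df n : {linear P n.+1 -> P n} := \0.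
have Pz n (x : P n.+1) : x = 0 by apply: Z0.
unshelve eexists (@ProjResolution R X P df (idfun : {linear X -> X}) _ _ _ _).
- by case=> [|n] //=; apply: zeromod_projective.
- by move=> x; exists x.
- move=> x /=; by split=> [->|[y <-]]; [exists 0 | ].
- move=> n x; split=> _; last by [].
  by exists 0; rewrite [RHS]Pz linear0.
by case=> // n _ x; apply: Pz.
Qed.

(** A resolution of the kernel of a projective presentation of X is spliced onto that
    presentation. *)
Lemma pd_leS d (K P X : lmodType R) (i : {linear K -> P}) (p : {linear P -> X}) :
  ses i p -> projective P -> pd_le d K -> pd_le d.+1 X.
Proof.
move=> sip prP [Q Qd].
pose S n : lmodType R := if n is m.+1 then Q m else P.
pose df n : {linear S n.+1 -> S n} :=
  match n return {linear S n.+1 -> S n} with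
  | 0 => i \o res_aug Q | m.+1 => res_diff Q m end.
have [inj_i exip sp] := sip.
unshelve eexists (@ProjResolution R X S df p _ _ _ _) => //.
- by case=> [|n] //=; apply: res_proj.
- move=> y /=; rewrite exip; split=> [[x <-]|[x <-]]; last by exists (res_aug Q x).
  by have [z <-] := res_surj Q x; exists z.
- case=> [|n] y /=; last exact: res_kerS.
  rewrite -res_ker0; split=> [/(inj0 inj_i) //|->]; exact: linear0.
by case=> // n; apply: Qd.
Qed.

(** Ext^(d+1)(X, -) is Ext^1 of the d-th syzygy; once it vanishes, the short exact
    sequence that covers this syzygy splits. *)
Lemma pd_le_Ext d X : enough_injectives -> fgmod X ->
  (forall Y, fgmod Y -> Ext_eq0 d.+1 X Y) -> pd_le d X.
Proof.
move=> enough; elim: d X => [|d IHd] X fgX EX;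
    have [K [P [i [p [sip prP fgP fgK]]]]] := syzygy_ex fgX.
  apply: pd_le0 => Y Z g f sg.
  have [s sE] := Ext1_lift sip idfun fgX (EX _ fgK).
  have [h hE] := prP Y Z g (f \o p) sg.
  by exists (h \o s) => x; rewrite /= hE /= sE.
apply: (pd_leS sip prP); apply: IHd => // Y fgY.
apply: (Ext_ker enough sip fgK fgP fgY) (EX _ fgY).
exact: Ext_projective_eq0.
Qed.

End Homological.

(** * Finite direct sums *)

Section FiniteSums.
Variable R : pzRingType.
Implicit Types X Y Z D : lmodType R.

Lemma ffun_closed (C : lmodType R -> Prop) D n :
    (forall X Y, isomod X Y -> C X -> C Y) -> (forall X, zeromod X -> C X) ->
    (forall X Y, C X -> C Y -> C (X * Y)%type) -> C D ->
  C ({ffun 'I_n -> D} : lmodType R).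
Proof.
move=> Ciso C0 Csum CD; elim: n => [|n IHn].
  by apply: C0 => x; apply/ffunP; case.
apply: Ciso (Csum _ _ CD IHn).
have [|h hE] := @linear_of_fun R (D * {ffun 'I_n -> D})%type {ffun 'I_n.+1 -> D}
    (fun xy => [ffun j => if unlift ord0 j is Some j' then xy.2 j' else xy.1]).
  move=> a [x f] [y g] /=; apply/ffunP=> j; rewrite !ffunE.
  by case: (unlift ord0 j) => //= j'; rewrite !ffunE.
apply: (isomodP (f := h)).
  apply: injP => -[x f]; rewrite hE /= => eq0; congr pair.
    by have := congr1 (fun G => fun_of_fin G ord0) eq0; rewrite !ffunE unlift_none.
  apply/ffunP=> j; have := congr1 (fun G => fun_of_fin G (lift ord0 j)) eq0.
  by rewrite !ffunE liftK.
move=> F; exists (F ord0, [ffun j => F (lift ord0 j)]); rewrite hE.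
apply/ffunP=> j; rewrite !ffunE /=.
by case: unliftP => [j' ->|-> //]; rewrite ffunE.
Qed.

Lemma fgmod_zero X : zeromod X -> fgmod X.
Proof. by move=> X0; exists 0%N, (fun _ => 0) => x; exists (fun _ => 0); rewrite big_ord0. Qed.

Lemma fgmod_iso X Y : isomod X Y -> fgmod X -> fgmod Y.
Proof. by case=> f [g _ gK]; apply: (@fgmod_surj R X Y f) => y; exists (g y). Qed.

Lemma fgmod_sum X Y : fgmod X -> fgmod Y -> fgmod (X * Y)%type.
Proof.
move=> [n [e gene]] [m [f genf]].
exists (n + m)%N, (fun j => match split j with inl j => (e j, 0) | inr j => (0, f j) end).
move=> [x y]; have [c xE] := gene x; have [c' yE] := genf y.
exists (fun j => match split j with inl j => c j | inr j => c' j end).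
rewrite big_split_ord /=.
rewrite (eq_bigr (fun j => c j *: ((e j, 0) : X * Y))); last first.
  by move=> j _; rewrite -[lshift _ _]/(unsplit (inl j)) unsplitK.
rewrite [X in _ + X](eq_bigr (fun j => c' j *: ((0, f j) : X * Y))); last first.
  by move=> j _; rewrite -[rshift _ _]/(unsplit (inr j)) unsplitK.
have fst_sum p (F : 'I_p -> X * Y) : (\sum_j F j).1 = \sum_j (F j).1.
  by elim/big_rec2: _ => // j u v _ <-.
have snd_sum p (F : 'I_p -> X * Y) : (\sum_j F j).2 = \sum_j (F j).2.
  by elim/big_rec2: _ => // j u v _ <-.
apply: injective_projections; rewrite /= ?fst_sum ?snd_sum /=.
  by rewrite [X in _ + X]big1 ?addr0 // => j _; apply: scaler0.
by rewrite [X in X + _]big1 ?add0r // => j _; apply: scaler0.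
Qed.

Lemma fgmod_ffun n D : fgmod D -> fgmod ({ffun 'I_n -> D} : lmodType R).
Proof.
apply: ffun_closed; [exact: fgmod_iso|exact: fgmod_zero|exact: fgmod_sum].
Qed.

Lemma joint_map n X D (u : 'I_n -> {linear X -> D}) :
  exists h : {linear X -> {ffun 'I_n -> D}}, forall x j, h x j = u j x.
Proof.
have [|h hE] := @linear_of_fun R X {ffun 'I_n -> D} (fun x => [ffun j => u j x]).
  by move=> a x y; apply/ffunP=> j; rewrite !ffunE linearP.
by exists h => x j; rewrite hE ffunE.
Qed.

Lemma ffun_coord n D (j : 'I_n) :
  exists h : {linear {ffun 'I_n -> D} -> D}, forall x, h x = x j.
Proof. by apply: linear_of_fun => a x y; rewrite !ffunE. Qed.

Lemma injective_ffun n D : injective_module D ->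
  injective_module ({ffun 'I_n -> D} : lmodType R).
Proof.
move=> injD X Y i f inj_i.
have /choice[u uE] : forall j, exists u : {linear Y -> D}, forall x, u (i x) = f x j.
  move=> j; have [c cE] := ffun_coord D j.
  by have [u uE] := injD _ _ i (c \o f) inj_i; exists u => x; rewrite uE /= cE.
have [h hE] := joint_map u; exists h => x.
by apply/ffunP=> j; rewrite hE uE.
Qed.

End FiniteSums.

(** * Linear functionals on vector spaces *)

Section Functionals.
Variable k : fieldType.

Local Open Scope classical_set_scope.

(** Zorn's lemma on graphs of partially defined functionals: a linear subspace G
    of V x k is such a graph when (0, c) in G forces c = 0. The empty set is added
    so that the union of an empty chain is allowed. *)
Lemma field_injective : injective_module (k^o : lmodType k).
Proof.
move=> W V i f inj_i.
pose good (G : set (V * k^o)) :=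
  [/\ submodule_pred G, forall c, G (0, c) -> c = 0 & forall w, G (i w, f w)].
pose P (G : set (V * k^o)) := good G \/ G = set0.
have [|G [PG maxG]] := @Zorn_bigcup (V * k^o)%type P.
  move=> F FP totF.
  have [[G0 [FG0 G0good]]|noG] := pselect (exists G, F G /\ good G); last first.
    right; apply/seteqP; split=> // x [G FG Gx].
    by case: (FP G FG) => [gG|G0]; [case: noG; exists G | rewrite G0 in Gx].
  have goodF G x : F G -> G x -> good G.
    by move=> FG Gx; case: (FP G FG) => // G0'; rewrite G0' in Gx.
  left; split.
  - split.
    + by exists G0 => //; case: G0good => -[].
    + move=> x y [G FG Gx] [H FH Hy].
      have [GH|HG] := totF _ _ FG FH.
        by exists H => //; have [[_ aD _] _ _] := goodF _ _ FH Hy; apply: aD => //; apply: GH.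
      by exists G => //; have [[_ aD _] _ _] := goodF _ _ FG Gx; apply: aD => //; apply: HG.
    + move=> a x [G FG Gx]; exists G => //.
      by have [[_ _ aZ] _ _] := goodF _ _ FG Gx; apply: aZ.
  - by move=> c [G FG Gc]; have [_ G0c _] := goodF _ _ FG Gc; apply: G0c.
  - by move=> w; exists G0 => //; case: G0good.
have gG : good G.
  case: PG => // G0; exfalso; apply: (maxG [set x | exists w, x = (i w, f w)]).
    rewrite G0; split; first by move=> x.
    by move=> /(_ (i 0, f 0)); apply; exists 0.
  left; split=> [|c [w [/esym/(inj0 inj_i)-> ->]]|w]; last by exists w.
    split=> [|_ _ [v ->] [w ->]|a _ [w ->]].
    + by exists 0; rewrite !linear0.
    + by exists (v + w); rewrite !linearD.
    + by exists (a *: w); rewrite !linearZ.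
  by rewrite linear0.
have [[G0 GD GZ] Gfun Gf] := gG.
have pZ a (x : V) (c : k^o) : a *: (x, c) = (a *: x, a *: c) by [].
have pD (x y : V) (c e : k^o) : (x, c) + (y, e) = (x + y, c + e) by [].
have tot x : exists c, G (x, c).
  apply: contrapT => nGx.
  have GxP a c : G (a *: x, c) -> a = 0.
    move=> Gac; apply/eqP/negP=> /negP a0; apply: nGx; exists (a^-1 *: c).
    by have := GZ a^-1 _ Gac; rewrite pZ scalerA mulVf // scale1r.
  (* extend the functional to the line through x by the value 0 *)
  apply: (maxG [set yc | exists a, G (yc.1 - a *: x, yc.2)]).
    split=> [[y c] Gyc|sub]; first by exists 0; rewrite /= scale0r subr0.
    by apply: nGx; exists 0; apply: sub; exists 1; rewrite /= scale1r subrr.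
  left; split=> [|c [a]|w].
  - split=> [|[y c] [y' c'] [a Ga] [a' Ga']|b [y c] [a Ga]].
    + by exists 0; rewrite /= scale0r subr0.
    + exists (a + a') => /=; have := GD _ _ Ga Ga'.
      by rewrite pD /= scalerDl opprD addrACA.
    + exists (b * a) => /=; have := GZ b _ Ga.
      by rewrite pZ /= scalerBr scalerA.
  - rewrite /= sub0r -scaleNr => Gac; apply: Gfun.
    by have a0 := GxP _ _ Gac; rewrite a0 scale0r in Gac.
  - by exists 0; rewrite /= scale0r subr0.
have [|||h hE] := @linear_of_rel k V (k^o : lmodType k) (fun x c => G (x, c)) => //.
- move=> x y y' Gy Gy'; apply/eqP; rewrite -subr_eq0; apply/eqP/Gfun.
  have := GD _ _ Gy (GZ (-1) _ Gy').
  by rewrite pZ pD !scaleN1r subrr.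
- move=> a x x' y y' Gxy Gxy'; exact: (GD _ _ (GZ a _ Gxy) Gxy').
exists h => w; apply/eqP; rewrite -subr_eq0; apply/eqP/Gfun.
have := GD _ _ (hE (i w)) (GZ (-1) _ (Gf w)).
by rewrite pZ pD !scaleN1r subrr.
Qed.

Lemma functional_separate (V : lmodType k) (S : V -> Prop) v :
  submodule_pred S -> ~ S v ->
  exists f : {linear V -> k^o}, (forall x, S x -> f x = 0) /\ f v != 0.
Proof.
move=> clS nSv; have [Q [p [sp pE]]] := quotient_ex clS.
have pv0 : p v != 0 by apply/eqP => /pE.
have [|i iE] := @linear_of_fun k (k^o : lmodType k) Q (fun c => (c : k) *: p v).
  by move=> a x y; rewrite scalerDl scalerA.
have inj_i : injective i.
  by apply: injP => c; rewrite iE => /eqP; rewrite scaler_eq0 (negbTE pv0) orbF => /eqP.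
have [h hE] := field_injective idfun inj_i.
exists (h \o p); split=> [x /pE /= ->|]; first exact: linear0.
have := hE 1; rewrite iE scale1r /= => ->; exact: oner_neq0.
Qed.

(** A matrix of maximal rank among those whose row space is contained in S. *)
Lemma subspace_mx m (S : 'rV[k]_m -> Prop) : submodule_pred S ->
  exists B : 'M[k]_m, forall v, S v <-> (v <= B)%MS.
Proof.
move=> clS.
pose Pr r := `[< exists2 B : 'M[k]_m, (forall v, (v <= B)%MS -> S v) & \rank B = r >].
have exP : exists r, Pr r.
  exists 0%N; apply/asboolP; exists 0; last exact: mxrank0.
  by move=> v; rewrite submx0 => /eqP->; apply: sub_zero.
have ubP r : Pr r -> (r <= m)%N by move/asboolP=> [B _ <-]; apply: rank_leq_row.
have [r /asboolP[B BS rB] maxr] := ex_maxnP exP ubP.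
exists B => v; split=> [Sv|]; last exact: BS.
have : (\rank (B + v)%MS <= r)%N.
  apply: maxr; apply/asboolP; exists (B + v)%MS => // _ /sub_addsmxP[[a b] ->].
  apply: (sub_add clS); first by apply: BS; apply: submxMl.
  rewrite -[b]scale1r [b]mx11_scalar -scalemxAl mul_scalar_mx.
  by apply: (sub_scale clS); apply: (sub_scale clS).
rewrite -rB => le_rk; apply: submx_trans (addsmxSr B v) _.
by rewrite -(mxrank_leqif_sup (addsmxSl B v)) eqn_leq le_rk mxrankS // addsmxSl.
Qed.

End Functionals.

(** * Modules over a finite-dimensional algebra *)

Section FiniteDimension.
Variables (k : fieldType) (A : falgType k).
Implicit Types X Y Z : lmodType A^c.

(** An alias, so that a right A-module also carries its structure of vector space. *)
Definition kmod (X : lmodType A^c) : Type := X.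
HB.instance Definition _ X := GRing.Zmodule.on (kmod X).

Section KScale.
Variable X : lmodType A^c.

Definition kscale (c : k) (x : kmod X) : kmod X := (c%:A : A^c) *: (x : X).

Lemma kscaleA a b x : kscale a (kscale b x) = kscale (a * b) x.
Proof.
by rewrite /kscale scalerA; congr (_ *: _); rewrite [LHS]mulr_algr scalerA mulrC.
Qed.

Lemma kscale1 : left_id 1 kscale.
Proof. by move=> x; rewrite /kscale scale1r [LHS]scale1r. Qed.

Lemma kscaleDr : right_distributive kscale +%R.
Proof. by move=> a x y; rewrite /kscale [LHS]scalerDr. Qed.

Lemma kscaleDl x : {morph kscale^~ x : a b / a + b}.
Proof. by move=> a b; rewrite /kscale scalerDl [LHS]scalerDl. Qed.

HB.instance Definition _ := GRing.Zmodule_isLmodule.Build k (kmod X)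
  kscaleA kscale1 kscaleDr kscaleDl.

Lemma kscaleE (c : k) (x : kmod X) : c *: x = (c%:A : A^c) *: (x : X).
Proof. by []. Qed.

End KScale.

Lemma kmod_map X Y (f : {linear X -> Y}) :
  exists g : {linear kmod X -> kmod Y}, forall x, g x = f x.
Proof.
by apply: (@linear_of_fun k (kmod X) (kmod Y) f) => a x y; rewrite !kscaleE [LHS]linearP.
Qed.

Lemma scale_algl X (a : A) (c : k) (x : X) :
  ((c *: a : A) : A^c) *: x = (c%:A : A^c) *: ((a : A^c) *: x).
Proof. by rewrite scalerA; congr (_ *: _); rewrite [RHS]mulr_algr. Qed.

(** Being a quotient of k^m: the least such m is the dimension, and it decreases
    strictly along proper quotients. *)
Definition spanned m X : Prop :=
  exists p : {linear 'rV[k]_m -> kmod X}, surjection p.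

Lemma fgmod_spanned X : fgmod X -> exists m, spanned m X.
Proof.
move=> [n [e gen]]; pose N := \dim {:A}; pose b := vbasis {:A}.
exists (n * N)%N.
have [|p pE] := @linear_of_fun k 'rV[k]_(n * N) (kmod X)
  (fun v => \sum_i \sum_j (vec_mx v i j *: ((b`_j : A^c) *: e i : kmod X))).
  move=> a u v; rewrite scaler_sumr -big_split /=; apply: eq_bigr => i _.
  rewrite scaler_sumr -big_split /=; apply: eq_bigr => j _.
  by rewrite linearP !mxE scalerDl scalerA.
exists p => x; have [c ->] := gen x.
exists (mxvec (\matrix_(i, j) coord b j (c i : A))).
rewrite pE; apply: eq_bigr => i _.
have ciE : c i = \sum_(j < N) (coord b j (c i : A) *: b`_j : A).
  by apply: coord_vbasis; apply: memvf.
rewrite {1}ciE [RHS]scaler_suml; apply: eq_bigr => j _.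
by rewrite mxvecK mxE kscaleE -scale_algl.
Qed.

(** A nonzero vector v in the kernel would let a complement of v, which has
    dimension m - 1, still span X. *)
Lemma spanned_coord X m : spanned m X -> (forall n, spanned n X -> (m <= n)%N) ->
  exists c : {linear kmod X -> 'rV[k]_m}, bijective c.
Proof.
move=> [p sp] minm.
have inj_p : injective p.
  apply: injP => v pv; apply/eqP/negP=> /negP v0.
  have rk : \rank (v^C)%MS = m.-1.
    by rewrite mxrank_compl rank_rV v0 subn1.
  have m_gt0 : (0 < m)%N.
    by case: m v {p sp minm pv rk} v0 => // v; rewrite [v]thinmx0 eqxx.
  have : (m <= \rank (v^C)%MS)%N; last by rewrite rk leqNgt prednK // leqnn.
  apply: minm.
  have [|q qE] := @linear_of_fun k 'rV[k]_(\rank (v^C)%MS) (kmod X)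
    (fun u => p (u *m row_base (v^C)%MS)).
    by move=> a u w; rewrite mulmxDl -scalemxAl linearP.
  exists q => x; have [u <-] := sp x.
  have /sub_addsmxP[[a b] /= uE] : (u <= v + v^C)%MS.
    by apply: submx_full; apply: addsmx_compl_full.
  have /submxP[w wE] : (b *m (v^C)%MS <= row_base (v^C)%MS)%MS.
    by rewrite eq_row_base; apply: submxMl.
  exists w; rewrite qE -wE uE linearD [a]mx11_scalar mul_scalar_mx linearZ /=.
  by rewrite pv scaler0 add0r.
have [x|q qE] := lift_through (f := idfun) inj_p; first exact: sp.
by exists q; exists p => // x; apply: inj_p; rewrite qE.
Qed.

Lemma fgmod_coord X : fgmod X -> exists m (c : {linear kmod X -> 'rV[k]_m}), bijective c.
Proof.
move=> /fgmod_spanned[m0 sm0].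
have [|m /asboolP sm minm] := @ex_minnP (fun m => `[< spanned m X >]).
  by exists m0; apply/asboolP.
by exists m; apply: spanned_coord => // n sn; apply: minm; apply/asboolP.
Qed.

Lemma spanned_fgmod m X : spanned m X -> fgmod X.
Proof.
move=> [p sp]; exists m, (fun j => p (delta_mx 0 j)) => x; have [v <-] := sp x.
exists (fun j => (v 0 j)%:A : A^c); rewrite {1}[v]row_sum_delta linear_sum.
by apply: eq_bigr => j _; rewrite linearZ.
Qed.

(** A submodule is a subspace of k^m, hence spanned by the rows of a matrix. *)
Lemma noetherian_alg : noetherian A^c.
Proof.
move=> X Y i inj_i /fgmod_coord[m [c [c' cK c'K]]].
have [i' i'E] := kmod_map i.
pose f : {linear kmod X -> 'rV[k]_m} := c \o i'.
have inj_f : injective f.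
  by apply: inj_comp; [exact: can_inj cK | move=> x y; rewrite !i'E => /inj_i].
have [B BE] := subspace_mx (submodule_im f).
have [v|p pE] := lift_through (X := 'rV[k]_m) (f := mulmxr B) inj_f.
  by apply/BE; apply: submxMl.
apply: (@spanned_fgmod m); exists p => x.
have /submxP[v vE] : (f x <= B)%MS by apply/BE; exists x.
by exists v; apply: inj_f; rewrite pE vE.
Qed.

Definition dualmod : Type := 'Hom(A, k^o).
HB.instance Definition _ := GRing.Zmodule.on dualmod.

Definition dual_scale (a : A^c) (f : dualmod) : dualmod := (f \o amull (a : A))%VF.

Lemma dual_scaleE a f x : (dual_scale a f : 'Hom(A, k^o)) x = f ((a : A) * x).
Proof. by rewrite comp_lfunE lfunE. Qed.

Lemma dual_scaleA a b f : dual_scale a (dual_scale b f) = dual_scale (a * b) f.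
Proof. by apply/lfunP=> x; rewrite !dual_scaleE mulrA. Qed.

Lemma dual_scale1 : left_id 1 dual_scale.
Proof. by move=> f; apply/lfunP=> x; rewrite dual_scaleE mul1r. Qed.

Lemma dual_scaleDr : right_distributive dual_scale +%R.
Proof. by move=> a f g; apply/lfunP=> x; rewrite add_lfunE !dual_scaleE add_lfunE. Qed.

Lemma dual_scaleDl f : {morph dual_scale^~ f : a b / a + b}.
Proof.
by move=> a b; apply/lfunP=> x; rewrite add_lfunE !dual_scaleE mulrDl linearD.
Qed.

HB.instance Definition _ := GRing.Zmodule_isLmodule.Build A^c dualmod
  dual_scaleA dual_scale1 dual_scaleDr dual_scaleDl.

Lemma dualE (a : A^c) (f : dualmod) (x : A) : (a *: f : dualmod) x = f ((a : A) * x).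
Proof. exact: dual_scaleE. Qed.

Lemma fgmod_dual : fgmod (dualmod : lmodType A^c).
Proof.
pose b := vbasis {:'Hom(A, k^o)}.
exists (\dim {:'Hom(A, k^o)}), (fun j => b`_j : dualmod) => f.
exists (fun j => (coord b j f)%:A : A^c).
rewrite {1}[f](coord_vbasis (memvf _)); apply: eq_bigr => j _.
by apply/lfunP=> x; rewrite dualE scale_lfunE mulr_algl linearZ.
Qed.

(** The adjunction Hom_A(X, Hom_k(A, k)) = Hom_k(X, k); together with evaluation
    at 1 it turns extension of maps to the dual into extension of functionals. *)
Lemma dual_map X (l : {linear kmod X -> k^o}) :
  exists u : {linear X -> dualmod}, forall x a, u x a = l ((a : A^c) *: x).
Proof.
apply: (@linear_of_rel _ X dualmod (fun x f => forall a, f a = l ((a : A^c) *: x))).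
- move=> x.
  have [|g gE] := @linear_of_fun k A (k^o : lmodType k) (fun a => l ((a : A^c) *: x)).
    by move=> c a b; rewrite [_ *: x]scalerDl linearD scale_algl -linearZ.
  by exists (linfun g) => a; rewrite lfunE /= gE.
- by move=> x f g fE gE; apply/lfunP=> a; rewrite fE gE.
- move=> b x y f g fE gE a.
  by rewrite add_lfunE dualE fE gE -linearD scalerDr scalerA.
Qed.

Lemma dual_eval X (u : {linear X -> dualmod}) :
  exists l : {linear kmod X -> k^o}, forall x, l x = u x 1.
Proof.
apply: (@linear_of_fun k (kmod X) (k^o : lmodType k) (fun x => u x 1)) => a x y.
by rewrite linearP add_lfunE dualE mulr1 -[u x 1]/(u x 1) linearZ.
Qed.

Lemma injective_dual : injective_module (dualmod : lmodType A^c).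
Proof.
move=> X Y i f inj_i; have [l lE] := dual_eval f; have [i' i'E] := kmod_map i.
have inj_i' : injective i' by move=> x y; rewrite !i'E => /inj_i.
have [l' l'E] := field_injective l inj_i'; have [u uE] := dual_map l'.
exists u => x; apply/lfunP=> a.
by rewrite uE -linearZ -i'E l'E lE linearZ dualE mulr1.
Qed.

Lemma dual_separate X (x : X) :
  (forall u : {linear X -> dualmod}, u x = 0) -> x = 0.
Proof.
move=> ux; apply: contrapT => x0.
have [||l [_ lx]] := @functional_separate k (kmod X) (fun y => y = 0) x => //.
  by split=> [|y z -> ->|a y ->]; rewrite ?addr0 ?scaler0.
have [u uE] := dual_map l; move/eqP: lx; apply.
by have := uE x 1; rewrite scale1r ux => <-; rewrite zero_lfunE.
Qed.

Lemma functionals_finite X : fgmod X -> exists n (l : 'I_n -> {linear kmod X -> k^o}),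
  forall x, (forall j, l j x = 0) -> x = 0.
Proof.
move=> /fgmod_coord[m [c cbij]]; exists m.
have /choice[l lE] : forall j, exists l : {linear kmod X -> k^o}, forall x, l x = c x 0 j.
  by move=> j; apply: linear_of_fun => a x y; rewrite linearP !mxE.
exists l => x lx; apply: (bij_inj cbij); rewrite [RHS]linear0.
by apply/rowP=> j; rewrite -lE lx mxE.
Qed.

Lemma enough_injectives_alg : enough_injectives A^c.
Proof.
move=> Y fgY; have [n [l l0]] := functionals_finite fgY.
have /choice[u uE] := fun j => dual_map (l j).
have [i iE] := joint_map u.
have inj_i : injective i.
  apply: injP => y iy; apply: l0 => j.
  by have := uE j y 1; rewrite scale1r => <-; rewrite -iE iy ffunE zero_lfunE.
have [Z [p sip]] := ses_coker inj_i.
have fgI : fgmod ({ffun 'I_n -> dualmod} : lmodType A^c).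
  by apply: fgmod_ffun; apply: fgmod_dual.
exists _, Z, i, p; split=> //; first exact/injective_ffun/injective_dual.
by have [_ _ sp] := sip; apply: fgmod_surj sp fgI.
Qed.

End FiniteDimension.

(** * Retracts and pullbacks *)

Section Products.
Variable R : pzRingType.
Implicit Types X Y Z W K E C : lmodType R.

Lemma fst_lin X Y : exists h : {linear (X * Y)%type -> X}, forall z, h z = z.1.
Proof. by apply: linear_of_fun. Qed.

Lemma snd_lin X Y : exists h : {linear (X * Y)%type -> Y}, forall z, h z = z.2.
Proof. by apply: linear_of_fun. Qed.

Lemma pair_lin X Y Z (f : {linear Z -> X}) (g : {linear Z -> Y}) :
  exists h : {linear Z -> (X * Y)%type}, forall z, h z = (f z, g z).
Proof. by apply: linear_of_fun => a x y; rewrite !linearP. Qed.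

(** The complement is the kernel of the retraction. *)
Lemma retract_summand X Y (i : {linear Y -> X}) (e : {linear X -> Y}) :
  (forall y, e (i y) = y) -> exists K : lmodType R, isomod X (Y * K)%type.
Proof.
move=> ei; have se : surjection e by move=> y; exists (i y).
have [K [j sje]] := ses_ker se; exists K.
have [x|r rE] := ses_lift (f := idfun \- (i \o e)) sje.
  by rewrite /= linearB ei subrr.
have [h hE] := pair_lin e r.
have [inj_j _ _] := sje; apply: (isomodP (f := h)).
  apply: injP => x; rewrite hE => -[ex rx]; have := rE x.
  by rewrite /= rx ex !linear0 addr0 => <-.
move=> [y z]; exists (i y + j z); rewrite hE; congr pair.
  by rewrite linearD ei (ses0 _ sje) addr0.
by apply: inj_j; rewrite rE /= linearD ei (ses0 _ sje) addr0 addrC addKr.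
Qed.

Lemma pullback_ex Y W Z X (a : {linear Y -> W}) (p : {linear W -> Z}) (h : {linear X -> Z}) :
    ses a p ->
  exists (E : lmodType R) (b : {linear Y -> E}) (q : {linear E -> X}) (r : {linear E -> W}),
    [/\ ses b q, forall e, p (r e) = h (q e),
        exists j : {linear E -> (X * W)%type}, injective j
      & forall C (f : {linear C -> X}) (g : {linear C -> W}),
          (forall c, h (f c) = p (g c)) ->
        exists c : {linear C -> E}, forall x, q (c x) = f x /\ r (c x) = g x].
Proof.
move=> sap; have [p1 p1E] := fst_lin X W; have [p2 p2E] := snd_lin X W.
have [E [j [inj_j jE]]] :=
  submodule_ex (submodule_ker ((h \o p1) \- (p \o p2) : {linear (X * W)%type -> Z})).
have hp e : p (p2 (j e)) = h (p1 (j e)).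
  have /jE/eqP : exists e', j e' = j e by exists e.
  by rewrite subr_eq0 => /eqP.
have univ C (f : {linear C -> X}) (g : {linear C -> W}) : (forall c, h (f c) = p (g c)) ->
    exists c : {linear C -> E}, forall x, p1 (j (c x)) = f x /\ p2 (j (c x)) = g x.
  move=> hfg; have [m mE] := pair_lin f g.
  have [x|c cE] := lift_through (f := m) inj_j.
    by apply/jE; rewrite /= mE p1E p2E /= hfg subrr.
  by exists c => x; rewrite cE mE p1E p2E.
have [y|b bE] := univ Y \0 a; first by rewrite /= linear0 (ses0 _ sap).
have [inj_a exap sp] := sap.
exists E, b, (p1 \o j), (p2 \o j); split=> //; last by exists j.
split.
- by apply: injP => y by0; have [_] := bE y; rewrite by0 !linear0 => /esym/(inj0 inj_a).
- move=> e /=; split=> [e1|[y <-]]; last by have [-> _] := bE y.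
  have /exap[y ay] : p (p2 (j e)) = 0 by rewrite hp e1 linear0.
  exists y; apply: inj_j; have [b1 b2] := bE y.
  by apply: injective_projections; rewrite -?p1E -?p2E ?b1 ?b2 ?e1.
- move=> x; have [w pw] := sp (h x).
  have [|e ee] := (jE (x, w)).1; first by rewrite /= p1E p2E /= pw subrr.
  by exists e; rewrite /= ee p1E.
Qed.

End Products.

(** * Minimal left approximations *)

Section Fitting.
Variables (k : fieldType) (A : falgType k).
Implicit Types X Y C I : lmodType A^c.

Lemma inj_surj_rV m (g : {linear 'rV[k]_m -> 'rV[k]_m}) : injective g -> surjection g.
Proof.
move=> inj_g; have free : row_free (lin1_mx g).
  by apply: inj_row_free => v; rewrite mul_rV_lin1 => /(inj0 inj_g).
move=> v; exists (v *m invmx (lin1_mx g)).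
by rewrite -mul_rV_lin1 mulmxKV // -row_free_unit.
Qed.

Lemma inj_surj_fg X (s : {linear X -> X}) : fgmod X -> injective s -> surjection s.
Proof.
move=> /fgmod_coord[m [c [c' cK c'K]]] inj_s.
have [s' s'E] := kmod_map s.
have [|g gE] := @linear_of_fun k 'rV[k]_m 'rV[k]_m (fun v => c (s' (c' v))).
  move=> a u v; rewrite -linearP -[LHS]/(c _); congr (c _); rewrite -linearP.
  by congr (s' _); apply: (can_inj cK); rewrite linearP !c'K.
have sg : surjection g.
  apply: inj_surj_rV => u v; rewrite !gE => /(can_inj cK).
  by rewrite !s'E => /inj_s/(can_inj c'K).
move=> x; have [v gv] := sg (c x); exists (c' v).
by apply: (can_inj cK); rewrite -gv gE s'E.
Qed.

Lemma spanned_surj m X Y (p : {linear X -> Y}) : surjection p -> spanned m X -> spanned m Y.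
Proof.
move=> sp [q sq]; have [p' p'E] := kmod_map p; exists (p' \o q) => y.
by have [x <-] := sp y; have [v <-] := sq x; exists v; rewrite /= p'E.
Qed.

(** Composing with k^m -> X gives a surjection from k^m onto Y, that is, onto a
    space of dimension m. *)
Lemma spanned_inj m X Y (p : {linear X -> Y}) : surjection p -> spanned m X ->
  (forall n, spanned n Y -> (m <= n)%N) -> injective p.
Proof.
move=> sp [q sq] minm; have [p' p'E] := kmod_map p.
have [c [c' cK c'K]] := spanned_coord (spanned_surj sp (ex_intro _ q sq)) minm.
have injg : injective (c \o p' \o q : {linear _ -> _}).
  have sg : surjection (c \o p' \o q : {linear 'rV[k]_m -> 'rV[k]_m}).
    move=> v; have [x px] := sp (c' v); have [w qw] := sq x.
    by exists w; rewrite /= qw p'E px c'K.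
  have full : row_full (lin1_mx (c \o p' \o q)).
    apply/row_fullP; have /choice[h hE] := fun j => sg (delta_mx 0 j).
    exists (\matrix_j h j); apply/row_matrixP => j.
    by rewrite row_mul rowK mul_rV_lin1 hE rowE mulmx1.
  move=> u v; rewrite -!mul_rV_lin1; apply: row_free_inj.
  by rewrite row_free_unit -row_full_unit.
move=> x y pxy; have [u qu] := sq x; have [v qv] := sq y.
by rewrite -qu -qv; congr (q _); apply: injg; rewrite /= qu qv !p'E pxy.
Qed.

Lemma iter_lin X (s : {linear X -> X}) n :
  exists h : {linear X -> X}, forall x, h x = iter n s x.
Proof.
elim: n => [|n [h hE]]; first by exists idfun.
by exists (s \o h) => x; rewrite /= hE.
Qed.

(** The image I of a power of s whose dimension is minimal is mapped
    isomorphically to itself by that power; inverting the power on I gives the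
    retraction e. The exponent is n + 1 rather than n, so that I is contained in
    the image of s and the power says something about s. *)
Lemma fitting X (s : {linear X -> X}) : fgmod X ->
  exists n I (i : {linear I -> X}) (e : {linear X -> I}),
    [/\ injective i, forall x, (exists y, i y = iter n.+1 s x),
        forall y, e (i y) = y & forall x, iter n.+1 s x = 0 -> e x = 0].
Proof.
move=> fgX.
pose img n I (i : {linear I -> X}) :=
  injective i /\ forall x, (exists y, iter n.+1 s y = x) <-> exists y, i y = x.
have img_ex n : exists I (i : {linear I -> X}), img n I i.
  have [h hE] := iter_lin s n.+1.
  have [I [i [inj_i iE]]] := submodule_ex (submodule_im h); exists I, i; split=> // x.
  by rewrite -iE; split=> -[y <-]; exists y; rewrite hE.
pose Pr r := `[< exists n I (i : {linear I -> X}), img n I i /\ spanned r I >].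
have exP : exists r, Pr r.
  have [I [i imi]] := img_ex 0%N; have [inj_i _] := imi.
  have [r sr] := fgmod_spanned (noetherian_alg inj_i fgX).
  by exists r; apply/asboolP; exists 0%N, I, i.
have [r /asboolP[n [I [i [[inj_i imi] sr]]]] minr] := ex_minnP exP.
have fgI := noetherian_alg inj_i fgX.
have [h hE] := iter_lin s n.+1.
have [I' [i' [inj_i' imi']]] := img_ex (n + n.+1)%N.
have iter2 x : iter (n + n.+1).+1 s x = h (h x).
  by rewrite -addSn iterD !hE.
have [y|q qE] := lift_through (X := I) (f := h \o i) inj_i'.
  have [x xE] : exists x, iter n.+1 s x = i y by apply/imi; exists y.
  by apply/imi'; exists x; rewrite iter2 /= -xE -hE.
have sq : surjection q.
  move=> z; have [x xE] : exists x, iter (n + n.+1).+1 s x = i' z by apply/imi'; exists z.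
  have [y yE] : exists y, i y = h x by apply/imi; exists x; rewrite hE.
  by exists y; apply: inj_i'; rewrite qE /= yE -iter2 xE.
have inj_q : injective q.
  apply: (spanned_inj sq sr) => r' sr'; apply: minr; apply/asboolP.
  by exists (n + n.+1)%N, I', i'.
have inj_hi y : h (i y) = 0 -> y = 0.
  by move=> hi; apply: (inj0 inj_q); apply: (inj0 inj_i'); rewrite qE.
have [y|c cE] := lift_through (X := I) (f := h \o i) inj_i.
  by apply/imi; exists (i y); rewrite /= hE.
have sc : surjection c.
  apply: inj_surj_fg => //; apply: injP => y cy; apply: inj_hi.
  by have := cE y; rewrite cy linear0.
have [x|y|a|e eE] := @linear_of_rel _ X I (fun x y => h (i y) = h x).
- have [z zE] : exists z, i z = h x by apply/imi; exists x; rewrite hE.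
  by have [y cy] := sc z; exists y; rewrite -zE -cy cE.
- move=> z z' e1 e2; apply/eqP; rewrite -subr_eq0; apply/eqP/inj_hi.
  by rewrite !linearB e1 e2 subrr.
- by move=> x x' z z' e1 e2; rewrite !linearP e1 e2.
exists n, I, i, e; split=> //.
- by move=> x; apply/imi; exists x.
- move=> y; apply/eqP; rewrite -subr_eq0; apply/eqP/inj_hi.
  by rewrite !linearB eE subrr.
- by move=> x hx; apply: inj_hi; rewrite eE hE.
Qed.

(** Minimality in the usual sense, that s be invertible: a right inverse of an
    endomorphism of a finite-dimensional module is an inverse. *)
Definition left_minimal C X (f : {linear C -> X}) : Prop :=
  forall s : {linear X -> X}, (forall c, s (f c) = f c) ->
  exists t : {linear X -> X}, forall x, s (t x) = x.

(** Among all left approximations, one whose target has the least dimension: an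
    endomorphism fixing it has, by Fitting, powers whose image is a summand through
    which the approximation factors, so this summand is everything. *)
Lemma minimal_left_approximation (U : lmodType A^c -> Prop) C :
    subcategory U -> functorially_finite U -> fgmod C ->
  exists X (f : {linear C -> X}), left_approximation U f /\ left_minimal f.
Proof.
move=> subU ffU fgC.
pose Pr r := `[< exists X (f : {linear C -> X}), left_approximation U f /\ spanned r X >].
have exP : exists r, Pr r.
  have [_ [X [f fU]]] := ffU C fgC; have [r sr] := fgmod_spanned (subcat_fg subU fU.1).
  by exists r; apply/asboolP; exists X, f.
have [r /asboolP[X [f [[UX fU] sr]]] minr] := ex_minnP exP.
exists X, f; split=> // s sf; have fgX := subcat_fg subU UX.
have [n [I [i [e [inj_i imi ei e0]]]]] := fitting s fgX.
have snf c : iter n.+1 s (f c) = f c by elim: n.+1 => //= m ->; apply: sf.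
have [c|f' f'E] := lift_through (f := f) inj_i; first by rewrite -(snf c); apply: imi.
have UI : U I.
  have [K XIK] := retract_summand ei.
  exact: (subcat_summand subU (subcat_iso subU XIK UX)).
have inj_e : injective e.
  apply: (@spanned_inj r) => // [y|r' sr']; first by exists (i y).
  apply: minr; apply/asboolP; exists I, f'; split=> //; split=> // Y g UY.
  by have [h hE] := fU Y g UY; exists (h \o i) => c; rewrite /= f'E hE.
have inj_s : injective s.
  apply: injP => x sx; apply: (inj0 inj_e); apply: e0.
  by rewrite iterSr sx; elim: n {imi snf} => //= m ->; rewrite linear0.
by apply: (lift_through (f := idfun) inj_s); apply: inj_surj_fg.
Qed.

End Fitting.

(** * Traces and resolutions by a subcategory *)

Section Trace.
Variables (R : pzRingType) (U : lmodType R -> Prop).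
Hypothesis subU : subcategory U.
Implicit Types X Y Z W K G E N : lmodType R.

Definition trace X (x : X) : Prop :=
  exists W (u : {linear W -> X}) w, U W /\ u w = x.

Definition generated X : Prop := forall x : X, trace x.

Lemma trace_im W X (u : {linear W -> X}) w : U W -> trace (u w).
Proof. by exists W, u, w. Qed.

Lemma submodule_trace X : submodule_pred (@trace X).
Proof.
split=> [|_ _ [V [v [x [UV <-]]]] [W [w [y [UW <-]]]]|a _ [V [v [x [UV <-]]]]].
- have [Z Z0] := zero_ex R; rewrite -(linear0 (\0 : {linear Z -> X})).
  by apply: trace_im; apply: (subcat_zero subU).
- have [p1 p1E] := fst_lin V W; have [p2 p2E] := snd_lin V W.
  have -> : v x + w y = ((v \o p1) \+ (w \o p2) : {linear _ -> _}) (x, y).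
    by rewrite /= p1E p2E.
  by apply: trace_im; apply: (subcat_sum subU).
- by rewrite -linearZ; apply: trace_im.
Qed.

Lemma trace_map X Y (f : {linear X -> Y}) x : trace x -> trace (f x).
Proof. by case=> W [u [w [UW <-]]]; apply: (trace_im (f \o u)). Qed.

Lemma generated_in X : U X -> generated X.
Proof. by move=> UX x; apply: (trace_im idfun). Qed.

Lemma generated_surj X Y (p : {linear X -> Y}) :
  surjection p -> generated X -> generated Y.
Proof. by move=> sp gX y; have [x <-] := sp y; apply: trace_map. Qed.

Definition right_lifting (C : lmodType R -> Prop) W E (p : {linear W -> E}) : Prop :=
  forall Y (h : {linear Y -> E}), C Y -> exists h' : {linear Y -> W}, forall y, p (h' y) = h y.

Definition left_lifting (C : lmodType R -> Prop) Y W (f : {linear Y -> W}) : Prop :=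
  forall N (h : {linear Y -> N}), C N -> exists h' : {linear W -> N}, forall y, h' (f y) = h y.

(** Finite resolutions by objects of U in which every map onto a syzygy is a right
    U-approximation. Lifting arguments recurse on the kernel K, whatever the
    length. *)
Inductive U_resolved : lmodType R -> Prop :=
  | U_resolved0 E : zeromod E -> U_resolved E
  | U_resolvedS K W E (i : {linear K -> W}) (p : {linear W -> E}) :
      ses i p -> U W -> right_lifting U p -> U_resolved K -> U_resolved E.

Lemma U_resolved_inv E : U_resolved E ->
  exists K W (i : {linear K -> W}) (p : {linear W -> E}),
    [/\ ses i p, U W, right_lifting U p & U_resolved K].
Proof.
case=> [{}E E0|K W {}E i p sip UW lp rK]; last by exists K, W, i, p.
have [Z Z0] := zero_ex R.
exists Z, E, \0, idfun; split; [split|exact: (subcat_zero subU)| |exact: U_resolved0].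
- by apply: injP => z _; apply: Z0.
- by move=> x; split=> _; [exists 0; rewrite [RHS]E0 | exact: E0].
- by move=> x; exists x.
- by move=> Y h _; exists h.
Qed.

Lemma U_resolved_in X : U X -> U_resolved X.
Proof.
move=> UX; have [Z Z0] := zero_ex R.
apply: (@U_resolvedS Z X X \0 idfun) => //; last exact: U_resolved0.
- split; first by apply: injP => z _; apply: Z0.
  + by move=> x; split=> [/= ->|[y <-] //]; exists 0.
  + by move=> x; exists x.
- by move=> Y h _; exists h.
Qed.

End Trace.

(** * Splicing coresolutions *)

Section Coresolution.
Variable R : pzRingType.
Implicit Types C X D : lmodType R.

Definition coresolved (P : lmodType R -> Prop) n C : Prop :=
  exists (T : nat -> lmodType R) (f : {linear C -> T 0%N})
         (g : forall i, {linear T i -> T i.+1}),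
    [/\ forall i, (i <= n)%N -> P (T i), injective f, exact f (g 0%N) & exact_tail n.+1 g].

Lemma coresolved0 P C : P C -> coresolved P 0 C.
Proof.
move=> PC; have [Z Z0] := zero_ex R.
pose T n : lmodType R := if n is 0 then C else Z.
exists T, (idfun : {linear C -> C}), (fun n => \0 : {linear T n -> T n.+1}).
split=> [[|//]|//| |] //; first by move=> x; split=> [_|//]; exists x.
split=> [n y|[//|n] _]; last exact: Z0.
by split=> // _; exists 0; rewrite [RHS]Z0 linear0.
Qed.

Lemma coresolvedS P n C X D (f : {linear C -> X}) (q : {linear X -> D}) :
  ses f q -> P X -> coresolved P n D -> coresolved P n.+1 C.
Proof.
move=> [inj_f exfq sq] PX [T [e [g [PT inj_e exeg [exg T0]]]]].
pose S i : lmodType R := if i is j.+1 then T j else X.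
pose h i : {linear S i -> S i.+1} :=
  match i return {linear S i -> S i.+1} with 0 => e \o q | j.+1 => g j end.
exists S, f, h; split=> //; first by case=> [|i] //; apply: PT.
  move=> x /=; rewrite -exfq; split=> [/(inj0 inj_e) //|->]; exact: linear0.
split; last by case=> // i; apply: T0.
case=> [|i] y /=; last exact: exg.
rewrite exeg; split=> [[z <-]|[x <-]]; last by exists (q x).
by have [x <-] := sq z; exists x.
Qed.

End Coresolution.

(** * Functorially finite d-torsion classes *)

Section Torsion.
Variables (k : fieldType) (A : falgType k) (d : nat) (M U : lmodType A^c -> Prop).
Hypotheses (d_gt0 : (0 < d)%N) (ctM : cluster_tilting d M) (torU : torsion_class d M U).
Hypothesis ffU : functorially_finite U.
Implicit Types X Y Z W K G E C D N F V I J : lmodType A^c.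

Let enough : enough_injectives A^c := @enough_injectives_alg k A.
Let noeth : noetherian A^c := @noetherian_alg k A.

Let subM : subcategory M. Proof. by case: ctM. Qed.
Let subU : subcategory U. Proof. by case: torU. Qed.
Let ffM : functorially_finite M. Proof. by case: ctM. Qed.
Let UM X : U X -> M X. Proof. by case: torU => _ + _; apply. Qed.
Let M_fg X : M X -> fgmod X. Proof. exact: subcat_fg. Qed.
Let U_fg X : U X -> fgmod X. Proof. exact: subcat_fg. Qed.

Lemma M_Ext X N i : M X -> M N -> (0 < i < d)%N -> Ext_eq0 i X N.
Proof. by case: ctM => _ _ + _ => /(_ X)[+ _] => /[apply]-[_ E] MN /E; apply. Qed.

Lemma M_left X : fgmod X ->
  (forall N i, M N -> (0 < i < d)%N -> Ext_eq0 i X N) -> M X.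
Proof. by case: ctM => _ _ + _ => /(_ X)[_ +] fgX E; apply; split=> // N MN i; apply: E. Qed.

Lemma M_right N : fgmod N ->
  (forall X i, M X -> (0 < i < d)%N -> Ext_eq0 i X N) -> M N.
Proof. by case: ctM => _ _ _ /(_ N)[_ +] fgN E; apply; split=> // X MX i; apply: E. Qed.

Lemma M_projective X : fgmod X -> projective X -> M X.
Proof.
move=> fgX prX; apply: M_left => // N [//|i] MN _.
by apply: Ext_projective_eq0 => //; apply: M_fg.
Qed.

Lemma M_injective N : fgmod N -> injective_module N -> M N.
Proof. by move=> fgN injN; apply: M_right => // X [//|i] _ _; apply: Ext_injective. Qed.

Lemma M_dual : M (dualmod A : lmodType A^c).
Proof. by apply: M_injective; [apply: fgmod_dual | apply: injective_dual]. Qed.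

Local Notation tr := (trace U).
Local Notation Fac := (generated U).

(** The map from an object of U to N followed by N -> V_1 is killed by
    Hom(U, V_1) -> Hom(U, V_2), which is injective; so the subobject of N given by
    the torsion class is the trace. *)
Lemma torsion_sub N : M N -> exists W (u : {linear W -> N}),
  [/\ U W, injective u & forall x, tr x <-> exists w, u w = x].
Proof.
case: torU => _ _ /[apply]-[W [V [u [v [g [UW _ [inj_u exuv exvg _] homU]]]]]].
exists W, u; split=> // x; split=> [|[w <-]]; last exact: trace_im.
case=> Y [h [y [UY <-]]]; apply/exuv.
have [hom0 _] := homU Y UY; apply: (hom0 (v \o h)) => z.
by apply/exvg; exists (h z).
Qed.

Lemma trace_lift W N (u : {linear W -> N}) Y (h : {linear Y -> N}) :
    injective u -> (forall x, tr x <-> exists w, u w = x) -> Fac Y ->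
  exists h' : {linear Y -> W}, forall y, u (h' y) = h y.
Proof.
by move=> inj_u uE gY; apply: lift_through => // y; apply/uE; apply: trace_map.
Qed.

Lemma M_generated N : M N -> Fac N -> U N.
Proof.
move=> MN gN; have [W [u [UW inj_u uE]]] := torsion_sub MN.
apply: (subcat_iso subU) UW; apply: (isomodP inj_u) => x.
by apply/uE.
Qed.

(** Quotients are described by maps rather than by a chosen quotient module, so
    that images of N in other modules qualify. *)
Definition torsion_free_quotient N F : Prop :=
  exists p : {linear N -> F}, surjection p /\ forall x, p x = 0 <-> tr x.

Definition U_perp E : Prop := forall N F i, M N -> torsion_free_quotient N F ->
  (i < d)%N -> Ext_eq0 i E F.

Lemma tfq_ex N : exists F, torsion_free_quotient N F.
Proof.
have [F [p pE]] := quotient_ex (submodule_trace subU N).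
by exists F, p.
Qed.

Lemma tfq_fg N F : M N -> torsion_free_quotient N F -> fgmod F.
Proof. by move=> MN [p [sp _]]; apply: fgmod_surj sp (M_fg MN). Qed.

(** The quotient N / tr N is the kernel of V_1 -> V_2, and the successive kernels
    in V_1 -> V_2 -> ... are related by dimension shift: Ext^1(X, ker g_j) vanishes
    because Hom(X, -) keeps the sequence exact and Ext^1(X, V_j) = 0, and
    Ext^(i+1)(X, ker g_j) is controlled by Ext^i(X, ker g_(j+1)). *)
Lemma perp_in X : U X -> U_perp X.
Proof.
move=> UX N F n MN [p [sp pE]] n_d; have MX := UM UX.
have [_ _ /(_ N MN)[W [V [u [v [g [UW MV [inj_u exuv exvg [exg _]] homU]]]]]]] := torU.
have [hom0 homS] := homU X UX.
have trE x : tr x <-> v x = 0.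
  split=> [[Y [h [y [UY <-]]]]|/exuv[w <-]]; last exact: trace_im.
  have [hom0' _] := homU Y UY; apply: (hom0' (v \o h)) => z.
  by apply/exvg; exists (h z).
have [x /pE/trE //|e0 e0E] := descend (f := v) sp.
have inj_e0 : injective e0.
  apply: injP => z; have [x <-] := sp z; rewrite e0E => /trE.
  by move/pE.
have e0ker y : g 0%N y = 0 <-> exists z, e0 z = y.
  rewrite exvg; split=> [[x <-]|[z <-]]; first by exists (p x).
  by have [x <-] := sp z; exists x; rewrite e0E.
(* the short exact sequence 0 -> ker g_j -> V_j -> ker g_(j+1) -> 0 *)
have next j Z (e : {linear Z -> V j}) : injective e ->
    (forall y, g j y = 0 <-> exists z, e z = y) ->
    exists (Z' : lmodType A^c) (e' : {linear Z' -> V j.+1}) (q : {linear V j -> Z'}),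
    [/\ injective e', forall y, g j.+1 y = 0 <-> exists z, e' z = y, ses e q
      & forall y, e' (q y) = g j y].
  move=> inj_e eE; have [Z' [e' [inj_e' e'E]]] := submodule_ex (submodule_ker (g j.+1)).
  have [y|q qE] := lift_through (f := g j) inj_e'; first by apply/e'E; apply/exg; exists y.
  exists Z', e', q; split=> //; split=> // [y|z].
    by rewrite -eE -qE; split=> [->|/(inj0 inj_e') //]; rewrite linear0.
  have /exg[y gy] : g j.+1 (e' z) = 0 by apply/e'E; exists z.
  by exists y; apply: inj_e'; rewrite qE.
have higher i j Z (e : {linear Z -> V j}) : injective e ->
    (forall y, g j y = 0 <-> exists z, e z = y) -> (i.+1 + j < d)%N -> Ext_eq0 i.+1 X Z.
  elim: i j Z e => [|i IHi] j Z e inj_e eE ijd;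
      have [Z' [e' [q [inj_e' e'E seq qE]]]] := next j Z e inj_e eE.
    apply: (Ext1_submodule seq); last by apply: M_Ext => //; lia.
    move=> h; have /(homS j (e' \o h))[h' h'E] : forall x, g j.+1 ((e' \o h) x) = 0.
      by move=> x; apply/e'E; exists (h x).
    by exists h' => x; apply: inj_e'; rewrite qE -h'E.
  apply: (Ext_submodule seq); last by apply: M_Ext => //; lia.
  by apply: (IHi j.+1 Z' e') => //; lia.
case: n n_d => [|n] n_d; last by apply: (higher n 0%N F e0) => //; lia.
apply/Ext0P => // [|h x]; first exact: U_fg.
apply: (inj0 inj_e0); apply: (hom0 (e0 \o h)) => {}x.
by apply/e0ker; exists (h x).
Qed.

Fixpoint M_resolved m K : Prop :=
  match m with
  | 0 => M K
  | m'.+1 => exists (K' N : lmodType A^c) (j : {linear K' -> N}) (q : {linear N -> K}),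
               [/\ ses j q, M N, right_lifting M q & M_resolved m' K']
  end.

Lemma right_M_approximation K : fgmod K ->
  exists N (q : {linear N -> K}), [/\ surjection q, M N & right_lifting M q].
Proof.
move=> fgK; have [[N [q [MN lq]]] _] := ffM fgK; exists N, q; split=> // x.
have [n [p sp]] := free_cover fgK.
have Mfree : M ({ffun 'I_n -> A^c^o} : lmodType A^c).
  by apply: M_projective; [apply: fgmod_free | apply: projective_free].
have [p' p'E] := lq _ p Mfree; have [y <-] := sp x.
by exists (p' y).
Qed.

Lemma left_M_approximation Y : fgmod Y ->
  exists N (f : {linear Y -> N}), [/\ injective f, M N & left_lifting M f].
Proof.
move=> fgY; have [_ [N [f [MN lf]]]] := ffM fgY; exists N, f; split=> //.
apply: injP => y fy; apply: dual_separate => u.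
by have [u' <-] := lf _ u M_dual; rewrite fy linear0.
Qed.

(** Each right M-approximation makes one more Ext^i(M, -) vanish on the kernel; once
    they vanish for 0 < i < d, the kernel is in M. *)
Lemma M_resolved_ex m K : fgmod K -> (m < d)%N ->
  (forall X i, M X -> (0 < i)%N -> (i + m < d)%N -> Ext_eq0 i X K) -> M_resolved m K.
Proof.
elim: m K => [|m IHm] K fgK m_d EK.
  by apply: M_right => // X i MX /andP[i0 id]; apply: EK => //; lia.
have [N [q [sq MN lq]]] := right_M_approximation fgK.
have [K' [j sjq]] := ses_ker sq; exists K', N, j, q; split=> //.
have [inj_j _ _] := sjq; have fgK' := noeth inj_j (M_fg MN).
apply: IHm => // [|X [//|[|i]] MX _ imd]; first by lia.
  apply: (Ext1_submodule sjq); last by apply: M_Ext => //; lia.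
  by move=> h; apply: lq.
apply: (Ext_submodule sjq); last by apply: M_Ext => //; lia.
by apply: EK => //; lia.
Qed.

(** The induced map to N / tr N is a cocycle, hence a coboundary, and the bounding
    map lifts to N because the terms of P are projective. *)
Lemma Ext_at_trace G (P : proj_resolution G) j N F (g : {linear P j -> N}) :
    torsion_free_quotient N F -> Ext_at P j F -> (forall x, tr (g (res_diff P j x))) ->
  exists g' : {linear P j -> N}, coboundary g' /\ forall x, tr (g x - g' x).
Proof.
case=> p [sp pE] EF gtr.
have /EF : cocycle (p \o g : {linear P j -> F}) by move=> x; apply/pE.
case: j g EF gtr => [|j] g EF gtr /=.
  move=> pg; exists \0; split=> // x; rewrite /= subr0.
  by apply/pE.
case=> e eE; have [e' e'E] := res_proj e sp.
exists (e' \o res_diff P j); split; first by exists e'.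
by move=> x; apply/pE; rewrite /= linearB e'E eE subrr.
Qed.

(** Let N_. be the M-resolution of K. Lifting f along N_. gives a chain map from P
    to N_., shifted by j. The hypothesis makes it null-homotopic modulo tr N_.;
    correcting f by the degree j part of the homotopy moves its values into the
    image of tr N_0, that is, into the trace of K. The induction on m builds this
    homotopy from the far end of N_. *)
Lemma cocycle_trace m K : M_resolved m K ->
  forall G (P : proj_resolution G) j (f : {linear P j -> K}),
    (forall N F i, M N -> torsion_free_quotient N F -> (j <= i <= j + m)%N -> Ext_at P i F) ->
    cocycle f ->
  exists f' : {linear P j -> K}, coboundary f' /\ forall x, tr (f x - f' x).
Proof.
elim: m K => [|m IHm] K.
  move=> MK G P j f EF cf; have [F KF] := tfq_ex K.
  apply: (Ext_at_trace KF) => [|x]; first by apply: (EF K F j MK KF); lia.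
  by rewrite cf; exact: (sub_zero (submodule_trace subU _)).
case=> [K' [N [i [q [siq MN _ rK']]]]] G P j f EF cf.
have [inj_i _ sq] := siq; have [g gE] := res_proj f sq.
have [x|c cE] := ses_lift (f := g \o res_diff P j) siq; first by rewrite /= gE cf.
have [|x|c' [[h hE] c'tr]] := IHm K' rK' G P j.+1 c.
- by move=> N' F' l MN' NF' jl; apply: (EF N' F') => //; lia.
- by apply: inj_i; rewrite cE /= res_dd !linear0.
have [F NF] := tfq_ex N.
have [|x|g' [cg' g'tr]] := Ext_at_trace (P := P) (g := g \- (i \o h)) NF.
- by apply: (EF N F j MN NF); lia.
- by have := trace_map i (c'tr x); rewrite linearB cE hE.
exists (q \o g'); split.
  case: j g' cg' {f EF cf g gE c cE c' h hE c'tr g'tr} => [|j] g' /=.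
    by move=> g0 x; rewrite g0 linear0.
  by case=> e eE; exists (q \o e) => x; rewrite /= eE.
move=> x; have := trace_map q (g'tr x).
by rewrite /= !linearB gE (ses0 _ siq) subr0.
Qed.

(** The case of a cocycle in degree 0, where the only coboundary is zero. *)
Lemma M_resolved_trace m K G (i : {linear G -> K}) y : M_resolved m K -> fgmod G ->
    (forall N F l, M N -> torsion_free_quotient N F -> (l <= m)%N -> Ext_eq0 l G F) ->
  tr (i y).
Proof.
move=> rK /(resolution_ex noeth)[P _] EF; have [x <-] := res_surj P y.
have [||f' [f0 f'tr]] := cocycle_trace rK (P := P) (j := 0) (f := i \o res_aug P).
- by move=> N F l MN NF lm; apply: (EF N F).
- by move=> z; rewrite /= res_augd linear0.
by have := f'tr x; rewrite f0 subr0.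
Qed.

(** By the preceding lemma G is exactly the trace of K, so it is covered by tr N for
    the first term N of the M-resolution. The kernel of tr N -> G is a submodule of
    the next M-syzygy K' which again contains tr K', and Ext_ker shifts the
    vanishing hypothesis down by one degree: the induction proceeds on the pair
    made of a syzygy and its submodule. *)
Lemma U_resolved_M_resolved m K G (i : {linear G -> K}) :
    (m < d)%N -> M_resolved m K -> injective i -> (forall x, tr x -> exists y, i y = x) ->
    fgmod G ->
    (forall N F l, M N -> torsion_free_quotient N F -> (l <= m)%N -> Ext_eq0 l G F) ->
  U_resolved U G.
Proof.
elim: m K G i => [|m IHm] K G i m_d rK inj_i trG fgG EG;
    have imtr y := M_resolved_trace i y rK fgG EG.
  have [W [u [UW inj_u uE]]] := torsion_sub rK.
  have [y|h hE] := lift_through (f := i) inj_u; first by apply/uE.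
  apply: U_resolved_in; apply: (subcat_iso subU _ UW); apply: isomod_sym.
  apply: (isomodP (f := h)) => [y y' eqh|w]; first by apply: inj_i; rewrite -!hE eqh.
  have [y iy] := trG (u w) (trace_im u w UW).
  by exists y; apply: inj_u; rewrite hE.
have [K' [N [j [q [sjq MN lq rK']]]]] := rK.
have [W [u [UW inj_u uE]]] := torsion_sub MN.
have [w|a aE] := lift_through (f := q \o u) inj_i.
  exact: trG (trace_im (q \o u) w UW).
have la : right_lifting U a.
  move=> Y h UY; have [h1 h1E] := lq Y (i \o h) (UM UY).
  have [h2 h2E] := trace_lift h1 inj_u uE (generated_in UY).
  by exists h2 => y; apply: inj_i; rewrite aE /= h2E h1E.
have sa : surjection a.
  move=> y; have [Y [h [z [UY hz]]]] := imtr y.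
  have [z'|h1 h1E] := lift_through (f := h) inj_i; first exact/trG/trace_im.
  have [h2 h2E] := la Y h1 UY; exists (h2 z); apply: inj_i.
  by rewrite h2E h1E.
have [G' [b sba]] := ses_ker sa; have [inj_b exba _] := sba; have [inj_j exjq _] := sjq.
apply: (U_resolvedS sba UW la).
have [z|i' i'E] := ses_lift (f := u \o b) sjq.
  by rewrite -[q _]/((q \o u) (b z)) -aE (ses0 _ sba) linear0.
have fgG' := noeth inj_b (U_fg UW).
apply: (IHm K' G' i') => //; first by lia.
- move=> z z' eqz; apply: inj_b; apply: inj_u.
  by rewrite -[u (b z)]i'E -[u (b z')]i'E eqz.
- move=> x /(trace_map j)/uE[w uw].
  have /exba[z bz] : a w = 0.
    by apply: (inj0 inj_i); rewrite aE /= uw (ses0 _ sjq).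
  by exists z; apply: inj_j; rewrite i'E /= bz.
- move=> N' F l MN' NF lm; have fgF := tfq_fg MN' NF.
  apply: (Ext_ker noeth enough sba fgG' (U_fg UW) fgF); last by apply: (EG N' F).
  by apply: (perp_in UW MN' NF); lia.
Qed.

Lemma U_resolved_perp E : fgmod E -> U_perp E -> U_resolved U E.
Proof.
move=> fgE pE; apply: (@U_resolved_M_resolved d.-1 E E idfun) => //; first by lia.
- by apply: M_resolved_ex => //; [lia | move=> X i MX i0 id; lia].
- by move=> x _; exists x.
- by move=> N F l MN NF ld; apply: (pE N F) => //; lia.
Qed.

(** A map from Y to N in M has its values in tr N, which is in U. Approximations are
    injective because M contains the injective cogenerator. *)
Lemma generated_left_approximation Y : fgmod Y -> Fac Y ->
  exists W Z (f : {linear Y -> W}) (p : {linear W -> Z}),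
    [/\ ses f p, U W & left_lifting M f].
Proof.
move=> fgY gY; have [N [f [inj_f MN lf]]] := left_M_approximation fgY.
have [W [u [UW inj_u uE]]] := torsion_sub MN.
have [f' f'E] := trace_lift f inj_u uE gY.
have inj_f' : injective f' by move=> y y' eqf; apply: inj_f; rewrite -!f'E eqf.
have [Z [p sfp]] := ses_coker inj_f'; exists W, Z, f', p; split=> // N' h MN'.
by have [h' h'E] := lf N' h MN'; exists (h' \o u) => y; rewrite /= f'E h'E.
Qed.

(** Each left M-approximation makes one more Ext^i(-, M) vanish on the cokernel. *)
Lemma Ext_coker_left_M Y W Z (f : {linear Y -> W}) (p : {linear W -> Z}) r :
    ses f p -> M W -> left_lifting M f ->
    (forall N i, M N -> (0 < i)%N -> (i + r.+1 < d)%N -> Ext_eq0 i Y N) ->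
  forall N i, M N -> (0 < i)%N -> (i + r < d)%N -> Ext_eq0 i Z N.
Proof.
move=> sfp MW lf EY N [//|i] MN _ ir; have [inj_f _ _] := sfp.
have fgW := M_fg MW; have fgY := noeth inj_f fgW; have fgN := M_fg MN.
have EW : Ext_eq0 i.+1 W N by apply: M_Ext => //; lia.
case: i EW ir => [|i] EW ir.
  by apply: (Ext1_coker noeth enough sfp fgW fgN) => // h; apply: lf.
by apply: (Ext_coker noeth enough sfp fgY fgW fgN) => //; apply: EY => //; lia.
Qed.

(** By the hypothesis Y has a coresolution of length n by objects of M, and
    dimension shift along it leaves only Ext^0, ..., Ext^n below degree d. *)
Lemma Ext_M_codim n Y : fgmod Y ->
    (forall N i, M N -> (0 < i)%N -> (i + n < d)%N -> Ext_eq0 i Y N) ->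
  forall X i, M X -> (n < i < d)%N -> Ext_eq0 i X Y.
Proof.
elim: n Y => [|n IHn] Y fgY EY X i MX nid.
  apply: M_Ext => //; apply: M_left => // N j MN jd.
  by apply: EY => //; lia.
have [N [f [inj_f MN lf]]] := left_M_approximation fgY.
have [Z [p sfp]] := ses_coker inj_f; have [_ _ sp] := sfp.
case: i nid => [|i] nid; first by lia.
apply: (Ext_submodule sfp); last by apply: M_Ext => //; lia.
apply: (IHn Z); last by lia.
- exact: fgmod_surj sp (M_fg MN).
- exact: Ext_coker_left_M sfp MN lf EY.
- exact: MX.
Qed.

(** Let Y -> W be a left M-approximation with W in U and cokernel Z. Then
    Ext^d(X, Y) lies between Ext^(d-1)(X, Z), zero because Z has M-codimension at
    most d - 2, and Ext^d(X, W), zero because W is in U. *)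
Lemma Ext_projective_generated X Y :
  Ext_projective d U X -> fgmod Y -> Fac Y -> Ext_eq0 d X Y.
Proof.
move=> [UX EX] fgY gY; have MX := UM UX.
have [d1|d_gt1] : d = 1 \/ (1 < d)%N by lia.
  apply: EX; apply: M_generated => //; apply: M_left => // N i _; rewrite d1; lia.
have [W [Z [f [p [sfp UW lf]]]]] := generated_left_approximation fgY gY.
have [_ _ sp] := sfp; have fgZ := fgmod_surj sp (U_fg UW).
have EZ := Ext_coker_left_M (r := d.-2) sfp (UM UW) lf.
have {}EZ : Ext_eq0 d.-1 X Z.
  apply: (Ext_M_codim (n := d.-2) fgZ) => //; last by lia.
  by apply: EZ => N i _ i0; lia.
have := Ext_submodule sfp EZ; rewrite prednK //; apply; exact: EX.
Qed.

Definition killed X : Prop := forall a : A^c, (Ann U (a : A)) -> forall x : X, a *: x = 0.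

Lemma generated_killed X : Fac X -> killed X.
Proof.
move=> gX a /asboolP Ia x; have [W [u [w [UW <-]]]] := gX x.
by rewrite -linearZ Ia // linear0.
Qed.

(** A functional on Hom_k(A, k) that vanishes on the trace is evaluation at some a
    in A, and vanishing on all functions b |-> m(xb), for x in an object of U,
    means that a annihilates U. *)
Lemma dual_trace (f : dualmod A) : (forall a, Ann U a -> f a = 0) -> tr f.
Proof.
move=> fAnn; apply: contrapT => ntr.
have clS : @submodule_pred k 'Hom(A, k^o) (fun g => tr (g : dualmod A)).
  have [t0 tD tZ] := submodule_trace subU (dualmod A : lmodType A^c).
  split=> // c g /(tZ (c%:A : A^c)); congr tr.
  by apply/lfunP=> x; rewrite dualE scale_lfunE mulr_algl linearZ.
have [T [Ttr Tf]] := functional_separate clS ntr.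
pose b := vbasis {:A}.
have [|l lE] := @choice 'I_(\dim {:A}) 'Hom(A, k^o) (fun j g => forall x, g x = coord b j x).
  move=> j; have [|g gE] := @linear_of_fun k A (k^o : lmodType k) (coord b j).
    by move=> c x y; rewrite linearP.
  by exists (linfun g) => x; rewrite lfunE /= gE.
(* l is the basis dual to b, and T is evaluation at a *)
pose a : A := \sum_j (T (l j) : k) *: b`_j.
have Ta (g : 'Hom(A, k^o)) : T g = g a.
  have -> : g = \sum_(j < \dim {:A}) (g b`_j : k) *: l j.
    apply/lfunP=> x; rewrite sum_lfunE {1}(coord_vbasis (memvf x)) linear_sum.
    by apply: eq_bigr => j _; rewrite scale_lfunE lE linearZ /= [LHS]mulrC.
  rewrite linear_sum sum_lfunE; apply: eq_bigr => j _; rewrite linearZ /= scale_lfunE.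
  congr (_ *: _); rewrite lE /a linear_sum (bigD1 j) //= linearZ /=.
  rewrite coord_free ?(basis_free (vbasisP _)) // eqxx mulr1.
  rewrite big1 ?addr0 // => j' ne; rewrite linearZ /=.
  by rewrite coord_free ?(basis_free (vbasisP _)) // (negbTE ne) mulr0.
move/eqP: Tf; apply; rewrite Ta; apply: fAnn; apply/asboolP => X UX x.
apply: contrapT => ax0.
have [||m [_ mx]] := @functional_separate k (kmod X) (fun y => y = 0) ((a : A^c) *: x) => //.
  by split=> [|y z -> ->|c y ->]; rewrite ?addr0 ?scaler0.
have [u uE] := dual_map m; move/eqP: mx; apply.
by rewrite -uE -Ta; apply: Ttr; apply: trace_im.
Qed.

Lemma killed_dual_trace Y (u : {linear Y -> dualmod A}) y : killed Y -> tr (u y).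
Proof.
move=> kY; apply: dual_trace => a Ia.
have := dualE (a : A^c) (u y) 1; rewrite mulr1 -linearZ kY // linear0.
by rewrite zero_lfunE => <-.
Qed.

(** J is the trace of DA, that is, D(A / Ann U). *)
Lemma U_cogenerator : exists (J : lmodType A^c) (j : {linear J -> dualmod A}),
  [/\ U J, injective j,
      forall Y (u : {linear Y -> dualmod A}), killed Y ->
        exists h : {linear Y -> J}, forall y, j (h y) = u y
    & forall X n, U X -> (n < d)%N -> Ext_eq0 n.+1 X J].
Proof.
have [J [j [UJ inj_j jE]]] := torsion_sub M_dual; exists J, j; split=> //.
  move=> Y u kY; apply: lift_through => // y.
  by apply/jE; apply: killed_dual_trace.
move=> X n UX nd; have [F [p sjp]] := ses_coker inj_j.
apply: (Ext_submodule sjp); last by apply: Ext_injective; apply: injective_dual.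
apply: (perp_in UX M_dual) => //; have [_ exjp sp] := sjp; exists p; split=> // x.
by rewrite exjp jE.
Qed.

Lemma Ext_ffun m n X Y : Ext_eq0 n X Y -> Ext_eq0 n X ({ffun 'I_m -> Y} : lmodType A^c).
Proof.
move=> EY P f cf; have /choice[c cE] := @ffun_coord _ m Y.
have cfc j : cocycle (c j \o f : {linear P n -> Y}) by move=> x; rewrite /= cf linear0.
case: n f cf cfc EY => [|n] f cf cfc EY /=.
  by move=> x; apply/ffunP=> j; rewrite -cE ffunE; apply: (EY P _ (cfc j)).
have /choice[g gE] := fun j => EY P _ (cfc j).
have [h hE] := joint_map g; exists h => x.
by apply/ffunP=> j; rewrite hE -gE /= cE.
Qed.

Lemma U_ffun n X : U X -> U ({ffun 'I_n -> X} : lmodType A^c).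
Proof.
apply: ffun_closed; [exact: (subcat_iso subU)|exact: (subcat_zero subU)|].
exact: (subcat_sum subU).
Qed.

(** Finitely many functionals separate the elements of Y; each of them is a map to
    J, and the target is a power of J. Injectivity is relative to the modules
    killed by Ann U, the modules over A / Ann U. *)
Lemma killed_embedding Y : fgmod Y -> killed Y ->
  exists (I : lmodType A^c) (i : {linear Y -> I}),
  [/\ U I, injective i,
      forall V W (e : {linear V -> W}) (f : {linear V -> I}), killed W -> injective e ->
        exists h : {linear W -> I}, forall v, h (e v) = f v
    & forall X n, U X -> (n < d)%N -> Ext_eq0 n.+1 X I].
Proof.
move=> fgY kY; have [J [j [UJ inj_j jlift EJ]]] := U_cogenerator.
have [n [l l0]] := functionals_finite fgY.
have /choice[v vE] : forall s, exists v : {linear Y -> J}, forall y, j (v y) 1 = l s y.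
  move=> s; have [u uE] := dual_map (l s); have [v vE] := jlift Y u kY.
  by exists v => y; rewrite vE uE scale1r.
have [i iE] := joint_map v.
exists {ffun 'I_n -> J}, i; split.
- exact: U_ffun.
- apply: injP => y iy; apply: l0 => s.
  by rewrite -vE -iE iy ffunE linear0 zero_lfunE.
- move=> V W e f kW inj_e.
  have /choice[u uE] : forall s, exists u : {linear W -> J}, forall x, u (e x) = f x s.
    move=> s; have [c cE] := ffun_coord J s.
    have [w wE] := injective_dual (j \o c \o f) inj_e.
    have [u uE] := jlift W w kW; exists u => x; apply: inj_j.
    by rewrite uE wE /= cE.
  have [h hE] := joint_map u; exists h => x.
  by apply/ffunP=> s; rewrite hE uE.
- by move=> X m UX md; apply: Ext_ffun; apply: EJ.
Qed.

Lemma coker_perp Y W Z (f : {linear Y -> W}) (p : {linear W -> Z}) :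
  ses f p -> U W -> U_perp Y -> U_perp Z.
Proof.
move=> sfp UW pY N F i MN NF id; have [inj_f _ sp] := sfp.
have fgW := U_fg UW; have fgY := noeth inj_f fgW; have fgF := tfq_fg MN NF.
case: i id => [|i] id.
  apply/(Ext0P noeth) => [|h z]; first exact: fgmod_surj sp fgW.
  have [w <-] := sp z; have := perp_in UW MN NF d_gt0.
  by move/(Ext0P noeth _ fgW)/(_ (h \o p)); apply.
apply: (Ext_coker noeth enough sfp fgY fgW fgF); first by apply: (pY N F) => //; lia.
exact: (perp_in UW MN NF).
Qed.

Lemma coker_resolved Y W Z (f : {linear Y -> W}) (p : {linear W -> Z}) :
    ses f p -> U W -> U_resolved U Y -> (forall X, U X -> Ext_eq0 1 X Y) ->
  U_resolved U Z.
Proof.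
move=> sfp UW rY EY; apply: (U_resolvedS sfp UW _ rY) => X h UX.
by apply: (Ext1_lift noeth sfp) (EY X UX); apply: U_fg.
Qed.

(** The functor Ext^i(-, Y) on U is the cokernel of Hom(-, W) -> Hom(-, Z). The
    vanishing required of Y' passes to the pullbacks of W -> Z along maps from
    objects of U, and the resolution of Y' serves to lift maps along W -> Z. *)
Definition Ext_presented i Y : Prop :=
  exists Y' W Z (a : {linear Y' -> W}) (p : {linear W -> Z}),
  [/\ ses a p, U W /\ U Z, U_resolved U Y', U_perp Y'
    & forall X, U X -> Ext_eq0 i X Y <->
        forall h : {linear X -> Z}, exists h' : {linear X -> W}, forall x, p (h' x) = h x].

(** Left M-approximations Y -> W with W in U replace Ext^i(-, Y) by Ext^(i-1)(-, W / Y)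
    until i = 1. Meanwhile the M-codimension drops, so the last cokernel is in M,
    hence in U. *)
Lemma Ext_presented_generated i Y : (0 < i < d)%N -> fgmod Y -> Fac Y ->
    U_resolved U Y -> U_perp Y ->
    (forall N l, M N -> (0 < l)%N -> (l + i < d)%N -> Ext_eq0 l Y N) ->
    (forall X l, U X -> (0 < l < i)%N -> Ext_eq0 l X Y) ->
  Ext_presented i Y.
Proof.
case: i => [//|i]; elim: i Y => [|i IHi] Y id fgY gY rY pY EYM EUY;
    have [W [Z [f [p [sfp UW lf]]]]] := generated_left_approximation fgY gY;
    have [_ _ sp] := sfp; have fgW := U_fg UW; have fgZ := fgmod_surj sp fgW;
    have gZ := generated_surj sp (generated_in UW);
    have MW := UM UW.
  have UZ : U Z.
    apply: M_generated => //; apply: M_left => // N l MN ld.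
    by apply: (Ext_coker_left_M (r := 0) sfp MW lf) => //; lia.
  exists Y, W, Z, f, p; split=> // X UX; have MX := UM UX; split=> [EX h|lift].
    exact: (Ext1_lift noeth sfp h (U_fg UX) EX).
  by apply: (Ext1_submodule sfp lift); apply: M_Ext.
have [|||||N l MN l0 lid|X l UX lid|Y' [W' [Z' [a [q [saq UWZ rY' pY' E]]]]]] := IHi Z => //.
- by lia.
- by apply: (coker_resolved sfp UW rY) => X UX; apply: EUY => //; lia.
- exact: coker_perp sfp UW pY.
- exact: (Ext_coker_left_M (r := i.+1) sfp MW lf).
- apply: (Ext_quotient sfp); last by apply: EUY => //; lia.
  by apply: M_Ext => //; [apply: UM | lia].
exists Y', W', Z', a, q; split=> // X UX; rewrite -E //; have MX := UM UX; split=> EX.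
  by apply: (Ext_quotient sfp) EX; apply: M_Ext => //; lia.
by apply: (Ext_submodule sfp EX); apply: M_Ext.
Qed.

(** The first embedding is into an injective module over A / Ann U, because it has
    to kill Ext^d(-, V); an approximation of V inside M would be trivial. *)
Lemma Ext_presented_in V : U V -> Ext_presented d V.
Proof.
move=> UV; have fgV := U_fg UV; have gV := generated_in UV.
have [I [i [UI inj_i _ EI]]] := killed_embedding fgV (generated_killed gV).
have [Z [p sip]] := ses_coker inj_i; have [_ _ sp] := sip.
have fgI := U_fg UI; have fgZ := fgmod_surj sp fgI.
have gZ := generated_surj sp (generated_in UI).
have rV := U_resolved_in UV; have pV := perp_in UV.
have [d1|d_gt1] : d = 1 \/ (1 < d)%N by lia.
  exists V, I, Z, i, p; split=> //; first split=> //.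
    apply: M_generated => //; apply: M_left => // N l _; rewrite d1; lia.
  move=> X UX; split; rewrite d1.
    by move=> EX h; apply: (Ext1_lift noeth sip) EX; apply: U_fg.
  by move=> lift; apply: (Ext1_submodule sip lift); apply: EI.
have [|||||N l MN l0 ld|X l UX ld|Y' [W' [Z' [a [q [saq UWZ rY' pY' E]]]]]] :=
  @Ext_presented_generated d.-1 Z => //.
- by lia.
- by apply: (coker_resolved sip UI rV) => X UX; apply: M_Ext; [apply: UM|apply: UM|].
- exact: coker_perp sip UI pV.
- by lia.
- apply: (Ext_quotient sip); last by apply: M_Ext; [apply: UM|apply: UM|lia].
  by case: l ld => // l ld; apply: EI => //; lia.
exists Y', W', Z', a, q; split=> // X UX; rewrite -E // -{1}(prednK d_gt0); split=> EX.
  by apply: (Ext_quotient sip) EX; rewrite -(prednK (n := d.-1)); [apply: EI => // |]; lia.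
by apply: (Ext_submodule sip EX); apply: EI => //; lia.
Qed.

(** C lifts along the maps that occur in finite U-resolutions. Lifting of
    Ext^d-projective objects suffices for p, which lets W -> Z from the
    presentation of Ext^d be one of these maps. *)
Definition U_projective C : Prop :=
  forall K W E (i : {linear K -> W}) (p : {linear W -> E}),
    ses i p -> U W -> right_lifting (Ext_projective d U) p -> U_resolved U K ->
  forall c : {linear C -> E}, exists c' : {linear C -> W}, forall x, p (c' x) = c x.

Lemma projective_U_projective C : projective C -> U_projective C.
Proof. by move=> prC K W E i p [_ _ sp] _ _ _ c; apply: prC. Qed.

(** A map from D to E pulls back to X and lifts there. The lift restricted to C
    lands in the kernel K, where it lifts again along the resolution of K and then
    extends to X; subtracting this extension makes the lift vanish on C. *)
Lemma coker_U_projective C X D (f : {linear C -> X}) (q : {linear X -> D}) :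
    U_projective C -> left_approximation U f -> Ext_projective d U X ->
    exact f q -> surjection q ->
  U_projective D.
Proof.
move=> lamC [UX lf] epX exfq sq K W E i p sip UW lp rK c.
have [m mE] := lp X (c \o q) epX.
have qf x : q (f x) = 0 by apply/exfq; exists x.
have [x|g gE] := ses_lift (f := m \o f) sip; first by rewrite /= mE /= qf linear0.
have [K2 [W2 [i2 [p2 [sip2 UW2 lp2 rK2]]]]] := U_resolved_inv subU rK.
have [|g' g'E] := lamC _ _ _ i2 p2 sip2 UW2 _ rK2 g.
  by move=> V h [UV _]; apply: lp2.
have [e eE] := lf W2 g' UW2.
have [x /exfq[y <-]|c' c'E] := descend (f := m \- (i \o p2 \o e)) sq.
  by rewrite /= eE g'E gE subrr.
exists c' => x; have [y <-] := sq x.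
by rewrite c'E /= linearB (ses0 _ sip) subr0 mE.
Qed.

(** The class of h in Ext^d(X, V) becomes zero on C. Hence C maps to the pullback G,
    and through the first term W1 of a U-resolution of G, so through X. The
    composite X -> W1 -> G -> X fixes f, thus has an inverse t by minimality, and
    precomposing with t turns G -> W into a lift of h. *)
Lemma minimal_Ext_projective C X (f : {linear C -> X}) :
    U_projective C -> left_approximation U f -> left_minimal f ->
  Ext_projective d U X.
Proof.
move=> lamC [UX lf] minf; split=> // V UV.
have [Y [W [Z [a [p [sap [UW UZ] rY pY E]]]]]] := Ext_presented_in UV.
apply/E => // h.
(* an Ext^d-projective source has no obstruction in Ext^d(-, V) *)
have lp : right_lifting (Ext_projective d U) p.
  by move=> X' h' [UX' EX']; apply: (E X' UX').1; apply: EX'.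
have [e eE] := lamC _ _ _ a p sap UW lp rY (h \o f).
have [G [b [q [r [sbq rq [j inj_j] univ]]]]] := pullback_ex h sap.
have [x|g gE] := univ C f e; first by rewrite eE.
have fgX := U_fg UX; have [inj_b _ _] := sbq; have [inj_a _ _] := sap.
have fgG : fgmod G by apply: noeth inj_j _; apply: fgmod_sum => //; apply: U_fg.
have fgY : fgmod Y by apply: noeth inj_a _; apply: U_fg.
have pG : U_perp G.
  move=> N F i MN NF id; apply: (Ext_extension noeth enough sbq fgY fgG (tfq_fg MN NF)).
    exact: (pY N F i MN NF id).
  exact: (perp_in UX MN NF id).
have [K1 [W1 [i1 [p1 [sip1 UW1 lp1 rK1]]]]] := U_resolved_inv subU (U_resolved_perp fgG pG).
have [|g1 g1E] := lamC _ _ _ i1 p1 sip1 UW1 _ rK1 g.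
  by move=> X' h' [UX' _]; apply: lp1.
have [e1 e1E] := lf W1 g1 UW1.
have [x|t tE] := minf (q \o p1 \o e1).
  by rewrite /= e1E g1E; have [-> _] := gE x.
exists (r \o p1 \o e1 \o t) => x.
by rewrite /= rq -[q _]/((q \o p1 \o e1) (t x)) tE.
Qed.

(** The index n is the M-codimension of C. For n = 0 the module C is itself in U and
    is its own minimal approximation. *)
Lemma generated_coresolved n C : fgmod C -> Fac C -> U_projective C -> (n < d)%N ->
    (forall N i, M N -> (0 < i)%N -> (i + n < d)%N -> Ext_eq0 i C N) ->
  coresolved (Ext_projective d U) n C.
Proof.
elim: n C => [|n IHn] C fgC gC lamC nd EC.
  have UC : U C.
    by apply: M_generated => //; apply: M_left => // N i MN id; apply: EC => //; lia.
  apply: coresolved0; apply: (minimal_Ext_projective (f := idfun) lamC).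
    by split=> // Y g _; exists g.
  by move=> s sE; exists idfun.
have [X [f [Uf minf]]] := minimal_left_approximation subU ffU fgC.
have epX := minimal_Ext_projective lamC Uf minf; have [UX lf] := Uf.
have [W [Z [w [p [swp UW lw]]]]] := generated_left_approximation fgC gC.
have [inj_w _ _] := swp; have [w' w'E] := lf W w UW.
have inj_f : injective f by move=> x y eqf; apply: inj_w; rewrite -!w'E eqf.
have lfM : left_lifting M f.
  by move=> N h MN; have [h' h'E] := lw N h MN; exists (h' \o w') => y; rewrite /= w'E h'E.
have [D [q sfq]] := ses_coker inj_f; have [_ exfq sq] := sfq.
apply: (coresolvedS sfq epX); apply: IHn.
- exact: fgmod_surj sq (U_fg UX).
- exact: generated_surj sq (generated_in UX).
- exact: coker_U_projective lamC Uf epX exfq sq.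
- by lia.
- exact: Ext_coker_left_M sfq (UM UX) lfM EC.
Qed.

(** C is A / Ann U: an element of A is killed by the left U-approximation f of A if
    and only if it annihilates every element of every object of U. *)
Lemma regular_coresolved : exists C (p : {linear A^c^o -> C}),
  [/\ surjection p, forall a : A^c, p a = 0 <-> Ann U (a : A)
    & coresolved (Ext_projective d U) d C].
Proof.
have [prA fgA] : projective (A^c^o : lmodType A^c) /\ fgmod (A^c^o : lmodType A^c).
  split; last first.
    by exists 1%N, (fun _ => 1) => x; exists (fun _ => x); rewrite big_ord1 [RHS]mulr1.
  move=> Y Z g f sg; have [y gy] := sg (f 1).
  have [|h hE] := @linear_of_fun _ (A^c^o : lmodType A^c) Y (fun a => (a : A^c) *: y).
    by move=> a b c; rewrite scalerDl scalerA.
  by exists h => a; rewrite hE linearZ gy -linearZ [_ *: _]mulr1.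
have lamA := projective_U_projective prA.
have [X [f [Uf minf]]] := minimal_left_approximation subU ffU fgA.
have epX := minimal_Ext_projective lamA Uf minf; have [UX lf] := Uf.
have fker (a : A^c) : f a = 0 <-> Ann U (a : A).
  split=> [fa|/asboolP Ia]; last first.
    by rewrite -[a : A^c^o]mulr1 -[_ * _]/(a *: (1 : A^c^o)) linearZ; apply: Ia.
  apply/asboolP => Y UY y.
  have [|h hE] := @linear_of_fun _ (A^c^o : lmodType A^c) Y (fun a => (a : A^c) *: y).
    by move=> b c e; rewrite scalerDl scalerA.
  by have [h' h'E] := lf Y h UY; rewrite -hE -h'E fa linear0.
have [C [p [sp pE]]] := quotient_ex (submodule_ker f).
have [x /pE //|e eE] := descend (f := f) sp.
have inj_e : injective e.
  by apply: injP => c; have [a <-] := sp c; rewrite eE => /pE.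
have [D [q seq]] := ses_coker inj_e; have [_ exeq sq] := seq.
have exfq : exact f q.
  move=> x; rewrite exeq; split=> [[c <-]|[a <-]]; last by exists (p a).
  by have [a <-] := sp c; exists a.
exists C, p; split=> // [a|]; first by rewrite pE fker.
rewrite -[n in coresolved _ n _](prednK d_gt0); apply: (coresolvedS seq epX).
apply: generated_coresolved.
- exact: fgmod_surj sq (U_fg UX).
- exact: generated_surj sq (generated_in UX).
- exact: coker_U_projective lamA Uf epX exfq sq.
- by lia.
- by move=> N i _ i0; lia.
Qed.

End Torsion.

(** * Restriction of scalars along A -> A / I *)

Section Restriction.
Variables (A : pzRingType) (I : twoSidedIdeal A).
Local Notation B := (quot_ring I).
Local Open Scope quotient_scope.

(** An alias for the carrier of Y, viewed as a right A-module. *)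
Definition restriction (Y : lmodType B^c) : Type := Y.
HB.instance Definition _ Y := GRing.Zmodule.on (restriction Y).

Section Scale.
Variable Y : lmodType B^c.
Definition restr_scale (a : A^c) (y : restriction Y) : restriction Y :=
  ((\pi_B (a : A) : B) : B^c) *: (y : Y).

Lemma restr_scaleA a b y : restr_scale a (restr_scale b y) = restr_scale (a * b) y.
Proof.
rewrite /restr_scale (scalerA (_ : B^c)); congr (_ *: (y : Y)).
exact: (quot_pi_mul I b a).
Qed.

Lemma restr_scale1 : left_id 1 restr_scale.
Proof. by move=> y; rewrite /restr_scale [LHS](scale1r (y : Y)). Qed.

Lemma restr_scaleDr : right_distributive restr_scale +%R.
Proof. by move=> a x y; apply: (@scalerDr B^c Y). Qed.

Lemma restr_scaleDl y : {morph restr_scale^~ y : a b / a + b}.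
Proof.
move=> a b; rewrite /restr_scale -[RHS](scalerDl (y : Y)).
by congr (_ *: (y : Y)); rewrite [RHS](quot_pi_add I a b).
Qed.

HB.instance Definition _ := GRing.Zmodule_isLmodule.Build A^c (restriction Y)
  restr_scaleA restr_scale1 restr_scaleDr restr_scaleDl.

Lemma restrE (a : A) (y : restriction Y) :
  (a : A^c) *: y = ((\pi_B a : B) : B^c) *: (y : Y).
Proof. by []. Qed.

Lemma restr_killed (a : A^c) (y : restriction Y) : a \in (I : {pred A}) -> a *: y = 0.
Proof.
move=> Ia; rewrite (restrE a).
have -> : \pi_B (a : A) = 0 :> B.
  have /quot_eqP-> : (a : A) - 0 \in I by rewrite subr0.
  by apply: (@addrI B (\pi_B 0)); rewrite (quot_pi_add I 0 0) !addr0.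
exact: (scale0r (y : Y)).
Qed.
End Scale.

Lemma quot_scale_pi (X : lmodType A^c)
    (kX : forall a : A^c, a \in (I : {pred A}) -> forall x : X, a *: x = 0)
    (a : A) (x : quot_module kX) :
  ((\pi_B a : B) : B^c) *: x = (a : A^c) *: (x : X).
Proof. exact: quot_scaleE. Qed.

(** Hom sets over A and over A / I are equal; the lemmas below change the ring over
    which a given function is linear. *)
Section Transfer.
Variables (X X' : lmodType A^c).
Variables (kX : forall a : A^c, a \in (I : {pred A}) -> forall x : X, a *: x = 0).
Variables (kX' : forall a : A^c, a \in (I : {pred A}) -> forall x : X', a *: x = 0).
Variables (Y Y' : lmodType B^c).
Local Notation XB := (quot_module kX).
Local Notation XB' := (quot_module kX').

Lemma quot_map (f : {linear X -> X'}) : exists g : {linear XB -> XB'}, forall x, g x = f x.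
Proof.
apply: (@linear_of_fun B^c XB XB' f) => b x y; elim/quotW: b => a.
have eq1 := congr1 (fun z : X => f (z + (y : X))) (@quot_scale_pi X kX a x).
have eq2 := congr1 (fun z : X' => z + f y) (@quot_scale_pi X' kX' a (f x)).
exact: etrans eq1 (etrans (linearP f (a : A^c) x y) (esym eq2)).
Qed.

Lemma restr_map (f : {linear Y -> Y'}) :
  exists g : {linear restriction Y -> restriction Y'}, forall y, g y = f y.
Proof.
apply: (@linear_of_fun A^c (restriction Y) (restriction Y') f) => a x y.
exact: (linearP f ((\pi_B (a : A) : B) : B^c) x y).
Qed.

Lemma to_quot_map (f : {linear restriction Y -> X}) :
  exists g : {linear Y -> XB}, forall y, g y = f y.
Proof.
apply: (@linear_of_fun B^c Y XB f) => b x y; elim/quotW: b => a.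
have eq2 := congr1 (fun z : X => z + f y) (@quot_scale_pi X kX a (f x)).
exact: etrans (linearP f (a : A^c) x y) (esym eq2).
Qed.

Lemma to_unquot_map (f : {linear Y -> XB}) :
  exists g : {linear restriction Y -> X}, forall y, g y = f y.
Proof.
apply: (@linear_of_fun A^c (restriction Y) X f) => a x y.
have eq2 := congr1 (fun z : X => z + (f y : X)) (@quot_scale_pi X kX a (f x)).
exact: etrans (linearP f ((\pi_B (a : A) : B) : B^c) x y) eq2.
Qed.

Lemma from_quot_map (f : {linear XB -> Y}) :
  exists g : {linear X -> restriction Y}, forall x, g x = f x.
Proof.
apply: (@linear_of_fun A^c X (restriction Y) f) => a x y.
have eq1 := congr1 (fun z : X => f (z + (y : X))) (@quot_scale_pi X kX a x).
exact: etrans (esym eq1) (linearP f ((\pi_B (a : A) : B) : B^c) x y).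
Qed.

Lemma fgmod_quot : fgmod X -> fgmod (XB : lmodType B^c).
Proof.
move=> [n [e gen]]; exists n, e => x; have [c cE] := gen x.
exists (fun j => (\pi_B (c j : A) : B) : B^c); rewrite [LHS]cE.
by apply: eq_bigr => j _; apply/esym; apply: (@quot_scale_pi X kX (c j : A) (e j)).
Qed.

Lemma fgmod_restr : fgmod Y <-> fgmod (restriction Y : lmodType A^c).
Proof.
split=> -[n [e gen]]; exists n, e => y; have [c cE] := gen y.
  exists (fun j => repr (c j : B) : A^c); rewrite [LHS]cE.
  apply: eq_bigr => j _; rewrite [RHS](restrE (repr (c j : B)) (e j : restriction Y)).
  by rewrite reprK.
by exists (fun j => (\pi_B (c j : A) : B) : B^c); rewrite [LHS]cE; apply: eq_bigr.
Qed.

End Transfer.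

Lemma restr_quot_iso (X : lmodType A^c)
    (kX : forall a : A^c, a \in (I : {pred A}) -> forall x : X, a *: x = 0) :
  isomod X (restriction (quot_module kX) : lmodType A^c).
Proof.
have [f fE] := from_quot_map (idfun : {linear quot_module kX -> quot_module kX}).
by apply: (isomodP (f := f)) => [x y|y]; [rewrite !fE | exists y; rewrite fE].
Qed.

Lemma add_of_quot (X Y : lmodType A^c)
    (kX : forall a : A^c, a \in (I : {pred A}) -> forall x : X, a *: x = 0)
    (kY : forall a : A^c, a \in (I : {pred A}) -> forall y : Y, a *: y = 0) :
  add_of X Y -> add_of (quot_module kX : lmodType B^c) (quot_module kY).
Proof.
move=> [n [Z [f fbij]]]; have [f' fK f'K] := fbij.
have kZ (a : A^c) : a \in (I : {pred A}) -> forall z : Z, a *: z = 0.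
  move=> Ia z; have E0 : a *: f' (0, z) = 0 by apply/ffunP=> j; rewrite !ffunE kX.
  have E : f (a *: f' (0, z)) = a *: f (f' (0, z)) by rewrite linearZ.
  by rewrite E0 linear0 f'K in E; have := congr1 snd E.
pose XB := quot_module kX; pose YB := quot_module kY; pose ZB := quot_module kZ.
exists n, ZB.
have [|g gE] := @linear_of_fun B^c ({ffun 'I_n -> XB} : lmodType B^c) (YB * ZB)%type f.
  move=> b x y; elim/quotW: b => a.
  have eq1 : ((\pi_B a : B) : B^c) *: x = (a : A^c) *: (x : {ffun 'I_n -> X}).
    by apply/ffunP=> j; rewrite !ffunE; apply: (@quot_scale_pi X kX a (x j)).
  have eq2 : ((\pi_B a : B) : B^c) *: (f x : YB * ZB) = (a : A^c) *: f x.
    apply: injective_projections.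
      exact: (@quot_scale_pi Y kY a (f x).1).
    exact: (@quot_scale_pi Z kZ a (f x).2).
  have eq1' := congr1 (fun z : {ffun 'I_n -> X} => f (z + (y : {ffun 'I_n -> X}))) eq1.
  have eq2' := congr1 (fun z : (Y * Z)%type => z + f y) eq2.
  exact: etrans eq1' (etrans (linearP f (a : A^c) x y) (esym eq2')).
by exists g; exists f' => x; rewrite gE.
Qed.

End Restriction.

(** * The tilting module over A / Ann U *)

Section Quotient.
Variables (k : fieldType) (A : falgType k) (d : nat) (M U : lmodType A^c -> Prop).
Hypotheses (d_gt0 : (0 < d)%N) (ctM : cluster_tilting d M) (torU : torsion_class d M U).
Hypothesis ffU : functorially_finite U.
Local Open Scope quotient_scope.
Local Notation B := (quot_ring (Ann U)).
Implicit Types (X : lmodType A^c) (Y : lmodType B^c).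

Let subU : subcategory U. Proof. by case: torU. Qed.

Lemma noetherian_quot : noetherian B^c.
Proof.
move=> X Y i inj_i /fgmod_restr fgY; apply/fgmod_restr.
have [i' i'E] := restr_map i; apply: (noetherian_alg (i := i') _ fgY) => x y.
by rewrite !i'E; apply: inj_i.
Qed.

(** The embedding is kept together with its restriction to A, on which the vanishing
    of Ext over A is known. *)
Lemma quot_embedding Y : fgmod Y ->
  exists J (UJ : U J) (Z : lmodType B^c) (i : {linear Y -> Ann_module UJ})
         (p : {linear Ann_module UJ -> Z}) (i' : {linear restriction Y -> J})
         (p' : {linear J -> restriction Z}),
  [/\ ses i p, ses i' p' /\ (forall x, p' x = p x),
      injective_module (Ann_module UJ : lmodType B^c)
    & forall X n, U X -> (n < d)%N -> Ext_eq0 n.+1 X J].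
Proof.
move=> /fgmod_restr fgY.
have kY : killed U (restriction Y) by move=> a Ia y; apply: restr_killed.
have [J [i' [UJ inj_i' injJ EJ]]] := killed_embedding d_gt0 ctM torU fgY kY.
have [i iE] := to_quot_map (Ann_killed UJ) i'.
have inj_i : injective i by move=> x y; rewrite !iE => /inj_i'.
have [Z [p sip]] := ses_coker inj_i; have [_ exip sp] := sip.
have [p' p'E] := from_quot_map p.
exists J, UJ, Z, i, p, i', p'; split=> //.
  split=> //; split=> // [y|z]; last by have [y <-] := sp z; exists y; rewrite p'E.
  by rewrite p'E exip; split=> -[x <-]; exists x; rewrite iE.
move=> V W e f inj_e.
have [e' e'E] := restr_map e; have [f' f'E] := to_unquot_map f.
have [||h hE] := injJ _ _ e' f'.
- by move=> a Ia y; apply: restr_killed.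
- by move=> x y; rewrite !e'E => /inj_e.
have [h' h'E] := to_quot_map (Ann_killed UJ) h.
by exists h' => x; rewrite h'E -e'E hE f'E.
Qed.

Lemma fgmod_Ann_module X (UX : U X) : fgmod (Ann_module UX : lmodType B^c).
Proof. by apply: fgmod_quot; apply: (subcat_fg subU). Qed.

Lemma enough_injectives_quot : enough_injectives B^c.
Proof.
move=> Y /quot_embedding[J [UJ [Z [i [p [_ [_ [sip _ injJ _]]]]]]]].
have fgJ := fgmod_Ann_module UJ.
exists (Ann_module UJ), Z, i, p; split=> //.
by have [_ _ sp] := sip; apply: fgmod_surj sp fgJ.
Qed.

(** The modules J are injective over A / Ann U and acyclic for Ext_A(X, -) in
    degrees up to d, so a dimension shift along them is possible over both rings;
    in degree 1 both sides say that maps to Z lift to J. *)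
Lemma Ext_Ann_module n X (UX : U X) Y : (n < d)%N -> fgmod Y ->
  Ext_eq0 n.+1 X (restriction Y) -> Ext_eq0 n.+1 (Ann_module UX) Y.
Proof.
elim: n Y => [|n IHn] Y nd fgY EY;
    have [J [UJ [Z [i [p [i' [p' [sip [sip' p'E] injJ EJ]]]]]]]] := quot_embedding fgY;
    have [_ _ sp] := sip.
  apply: (Ext1_submodule sip _ (Ext_injective injJ)) => h; have [h' h'E] := from_quot_map h.
  have [e eE] := Ext1_lift (@noetherian_alg k A) sip' h' (subcat_fg subU UX) EY.
  have [e' e'E] := quot_map (Ann_killed UX) (Ann_killed UJ) e.
  by exists e' => x; rewrite e'E -p'E eE h'E.
apply: (Ext_submodule sip _ (Ext_injective injJ)); apply: IHn.
- by lia.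
- exact: fgmod_surj sp (fgmod_Ann_module UJ).
- by apply: (Ext_quotient sip') EY; apply: EJ => //; lia.
Qed.

(** Shift once: the cokernel Z of Y -> J is generated by U. *)
Lemma Ext_Ann_module_top m X (UX : U X) Y : Ext_projective d U X -> fgmod Y ->
  Ext_eq0 (d + m).+1 (Ann_module UX) Y.
Proof.
move=> epX; elim: m Y => [|m IHm] Y fgY;
    have [J [UJ [Z [i [p [i' [p' [sip [[_ _ sp'] _] injJ _]]]]]]]] := quot_embedding fgY;
    have [_ _ sp] := sip; have fgZ := fgmod_surj sp (fgmod_Ann_module UJ).
  rewrite addn0; apply: (Ext_submodule sip _ (Ext_injective injJ)).
  rewrite -[n in Ext_eq0 n _ _](prednK d_gt0); apply: Ext_Ann_module => //; first by lia.
  rewrite (prednK d_gt0).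
  apply: (Ext_projective_generated d_gt0 ctM torU epX); first exact/fgmod_restr.
  exact: generated_surj sp' (generated_in UJ).
by rewrite addnS; apply: (Ext_submodule sip _ (Ext_injective injJ)); apply: IHm.
Qed.

Lemma Ext_Ann_module_self X (UX : U X) i : Ext_projective d U X -> (0 < i)%N ->
  Ext_eq0 i (Ann_module UX) (Ann_module UX).
Proof.
move=> epX i0; have fgX := fgmod_Ann_module UX.
have [id|id] := leqP i d; last first.
  by rewrite -(subnKC id); apply: Ext_Ann_module_top.
have UX' : U (restriction (Ann_module UX)).
  exact: subcat_iso subU _ _ (restr_quot_iso (Ann_killed UX)) UX.
case: i i0 id => // i _ id; apply: Ext_Ann_module => //.
have [_ EX] := epX; have [_ UM _] := torU.
have [lt_id|eq_id] : (i.+1 < d)%N \/ i.+1 = d by lia.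
  by apply: (M_Ext ctM); [apply: UM|apply: UM|].
by rewrite eq_id; apply: EX.
Qed.

(** The terms of the coresolution over A are killed by Ann U, so it is a sequence of
    modules over A / Ann U. Modules beyond the d-th term are zero, hence also
    killed. *)
Lemma quot_coresolved X (UX : U X) :
    (forall Y : lmodType A^c, Ext_projective d U Y -> add_of X Y) ->
  coresolved (add_of (Ann_module UX : lmodType B^c)) d (B^c^o : lmodType B^c).
Proof.
move=> genX.
have [C [p [sp pE [T [f [g [epT inj_f exfg [exg T0]]]]]]]] :=
  regular_coresolved d_gt0 ctM torU ffU.
have kT i (a : A^c) : a \in (Ann U : {pred A}) -> forall t : T i, a *: t = 0.
  have [id|id] := leqP i d; last by move=> _ t; apply: T0.
  by have [UT _] := epT i id; apply: Ann_killed.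
pose TB i : lmodType B^c := quot_module (@kT i).
have gB i : {h : {linear TB i -> TB i.+1} | forall t, h t = g i t}.
  by apply: cid; apply: quot_map.
have pi_eq (a b : A) : \pi_B a = \pi_B b -> p a = p b.
  move/quot_eqP => Iab; apply/eqP; rewrite -subr_eq0 -linearB; apply/eqP.
  by apply/pE.
have [b|b t t' [a <- <-] [a' aa' <-]|b x x' t t' [a <- <-] [a' <- <-]|fB fBE] :=
    @linear_of_rel _ (B^c^o : lmodType B^c) (TB 0%N)
      (fun b t => exists2 a : A, \pi_B a = b & f (p a) = t).
- by elim/quotW: b => a; exists (f (p a)), a.
- by rewrite (pi_eq _ _ aa').
- elim/quotW: b => c; exists (a * c + a').
    by rewrite -(quot_pi_add (Ann U) (a * c) a') -(quot_pi_mul (Ann U) a c).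
  rewrite -[a * c + a']/((c : A^c) *: (a : A^c^o) + (a' : A^c^o)) !linearP.
  congr (_ + _); apply/esym; exact: (@quot_scale_pi _ _ (T 0%N) (@kT 0%N) c (f (p a))).
have fBpi (a : A) : fB (\pi_B a) = f (p a).
  by have [a' /pi_eq aa' <-] := fBE (\pi_B a); rewrite aa'.
exists TB, fB, (fun i => sval (gB i)); split.
- move=> i id; apply: add_of_quot; apply: genX; exact: epT.
- apply: injP; elim/quotW=> a; rewrite fBpi => /(inj0 inj_f)/pE Ia.
  have -> : (0 : B) = \pi_B 0.
    by apply: (@addrI B (\pi_B 0)); rewrite (quot_pi_add (Ann U) 0 0) !addr0.
  by apply/quot_eqP; rewrite subr0.
- move=> t; rewrite (svalP (gB 0%N)) exfg; split=> [[c <-]|[b <-]].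
    by have [a <-] := sp c; exists (\pi_B a); apply: fBpi.
  by elim/quotW: b => a; exists (p a); rewrite -fBpi.
- split=> [i t|i id]; last by move=> t; apply: T0.
  rewrite (svalP (gB i.+1)) exg; split=> -[x <-]; exists x; rewrite ?(svalP (gB i)) //.
Qed.

End Quotient.

Theorem theorem1p2 (k : fieldType) (A : falgType k) (d : nat)
  (M U : lmodType A^c -> Prop) (MU : lmodType A^c) (U_MU : U MU) :
  (1 <= d)%N ->
  cluster_tilting d M ->
  torsion_class d M U ->
  functorially_finite U ->
  Ext_projective_generator d U MU ->
  basic MU ->
  tilting d (Ann_module U_MU).
Proof.
move=> d_gt0 ctM torU ffU [epMU genMU] _.
have fgMU : fgmod (Ann_module U_MU) by apply: fgmod_Ann_module torU _ _.
split=> //.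
- apply: (pd_le_Ext (noetherian_quot (U := U)) (enough_injectives_quot d_gt0 ctM torU)) => //.
  move=> Y fgY; rewrite -[d]addn0.
  exact: (Ext_Ann_module_top d_gt0 ctM torU epMU fgY).
- by move=> i i0; apply: (Ext_Ann_module_self d_gt0 ctM torU epMU i0).
- exact: (quot_coresolved d_gt0 ctM torU ffU U_MU genMU).
Qed.
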